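(* Let $0\le t<T$, let $\{\phi_j\}_{j=0}^{\infty}$ be an arbitrary complete orthonormal system of functions in the space $L_2([t,T])$, and let $i_1,i_2\in\{1,\ldots,m\}$ with $i_1\ne i_2$. For $q=0,1,2,\ldots$ let $$ \int\limits_t^T\left({\bf w}_s^{(i_1)}-{\bf w}_t^{(i_1)}\right)^{(q)}d{\bf w}_s^{(i_2)}=\sum_{j=0}^{q}\int\limits_t^T\phi_j(\tau)\,d{\bf w}_{\tau}^{(i_1)}\int\limits_t^T\int\limits_t^s\phi_j(\tau)\,d\tau\, d{\bf w}_{s}^{(i_2)} $$ be the approximation of the iterated Ito stochastic integral $\int_t^T\int_t^s d{\bf w}_{\tau}^{(i_1)}d{\bf w}_{s}^{(i_2)}$. Then $$ \int\limits_t^T\int\limits_t^s d{\bf w}_{\tau}^{(i_1)}d{\bf w}_{s}^{(i_2)}=\mathop{\rm l.i.m.}_{q\to\infty}\int\limits_t^T\left({\bf w}_s^{(i_1)}-{\bf w}_t^{(i_1)}\right)^{(q)}d{\bf w}_s^{(i_2)}=\mathop{\rm l.i.m.}_{q\to\infty}\sum_{j=0}^{q}\int\limits_t^T\phi_j(\tau)\,d{\bf w}_{\tau}^{(i_1)}\int\limits_t^T\int\limits_t^s\phi_j(\tau)\,d\tau\, d{\bf w}_{s}^{(i_2)}. $$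
   Context: $(\Omega,{\rm F},{\sf P})$ is a complete probability space with a nondecreasing right-continuous family of $\sigma$-algebras $\{{\rm F}_s\}$ of ${\rm F}$, and ${\bf w}_s$ is a standard $m$-dimensional Wiener process, adapted to $\{{\rm F}_s\}$, with independent components ${\bf w}_s^{(i)}$, $i=1,\ldots,m$. All stochastic integrals with respect to ${\bf w}^{(i)}$ are Ito integrals. The notation ${\rm l.i.m.}$ means the limit in the mean-square sense, i.e. in $L_2(\Omega,{\sf P})$. In each term of the sum, $\int_t^T\int_t^s\phi_j(\tau)d\tau\,d{\bf w}_s^{(i_2)}$ is the Ito integral over $s\in[t,T]$ of the nonrandom function $s\mapsto\int_t^s\phi_j(\tau)d\tau$. The process $\left({\bf w}_s^{(i)}-{\bf w}_t^{(i)}\right)^{(q)}$ is the approximation $$ \left({\bf w}_s^{(i)}-{\bf w}_t^{(i)}\right)^{(q)}=\sum_{j=0}^{q}\int\limits_t^s\phi_j(\tau)d\tau\cdot\int\limits_t^T\phi_j(\tau)d{\bf w}_{\tau}^{(i)},\qquad s\in[t,T]. $$ Its first factor is a nonrandom function of $s$, and its second factor is a random variable not depending on $s$. For $i_1\neq i_2$ its integral against $d{\bf w}_s^{(i_2)}$ is given by the displayed formula in the claim. *)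

(* Defs.v *)
From HB Require Import structures.
From mathcomp Require Import all_boot all_order all_algebra.
From mathcomp Require Import all_classical all_reals all_analysis.

Set Implicit Arguments.
Unset Strict Implicit.
Unset Printing Implicit Defensive.

Import Order.TTheory GRing.Theory Num.Theory.
Import numFieldNormedType.Exports.

Local Open Scope classical_set_scope.
Local Open Scope ring_scope.

Section L2_interval.
Context {R : realType}.
Local Notation mu := (@lebesgue_measure R).
Implicit Types (t T : R).

Definition L2_on t T (f : R -> R) : Prop :=
  measurable_fun `[t, T] f /\
  (\int[mu]_(x in `[t, T]) ((f x) ^+ 2)%:E < +oo)%E.

(* Only the values of [phi j] on [t, T] matter. Completeness is the density of
   the finite linear combinations of the [phi j] in L_2([t, T]). *)
Definition complete_orthonormal_system t T (phi : nat -> R -> R) : Prop :=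
  [/\ forall j, L2_on t T (phi j),
      forall j k,
        \int[mu]_(x in `[t, T]) (phi j x * phi k x) = (j == k)%:R &
      forall f, L2_on t T f -> forall e : R, 0 < e ->
        exists (n : nat) (c : nat -> R),
          (\int[mu]_(x in `[t, T])
              ((f x - \sum_(j < n) c j * phi j x) ^+ 2)%:E < e%:E)%E].

End L2_interval.

Section stochastic.
Context {R : realType} {d : measure_display} {Omega : measurableType d}.
Variable P : probability Omega R.
Local Notation mu := (@lebesgue_measure R).

(* The time index set is [0, +oo[: the values of the family at negative times
   are irrelevant. *)
Record filtration (F : R -> set (set Omega)) : Prop := Filtration {
  filtration_sigma_algebra : forall s, 0 <= s -> sigma_algebra setT (F s) ;
  filtration_measurable : forall s, 0 <= s -> F s `<=` measurable ;
  filtration_nondecreasing : forall s u, 0 <= s -> s <= u -> F s `<=` F u ;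
  filtration_right_continuous : forall s, 0 <= s ->
    \bigcap_(u in [set u | s < u]) F u = F s }.

Definition measurable_wrt (G : set (set Omega)) (X : Omega -> R) : Prop :=
  forall B : set R, measurable B -> G (X @^-1` B).

Definition independent (G H : set (set Omega)) : Prop :=
  forall A B, G A -> H B -> P (A `&` B) = (P A * P B)%E.

Definition mutually_independent (n : nat) (G : 'I_n -> set (set Omega)) : Prop :=
  forall (J : {set 'I_n}) (A : 'I_n -> set Omega),
    (forall i, i \in J -> G i (A i)) ->
    P (\big[setI/setT]_(i in J) A i) = (\prod_(i in J) P (A i))%E.

Definition sigma_process (X : R -> Omega -> R) : set (set Omega) :=
  <<s \bigcup_(s in [set s : R | 0 <= s])
        preimage_set_system setT (X s) measurable >>.

(* Adaptedness is understood in the sense required by Ito integration: the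
   increments after time s are independent of F_s. *)
Record wiener_process (F : R -> set (set Omega)) (m : nat)
    (W : 'I_m -> R -> Omega -> R) : Prop := WienerProcess {
  wiener0 : forall i, {ae P, forall w, W i 0 w = 0} ;
  wiener_adapted : forall i s, 0 <= s -> measurable_wrt (F s) (W i s) ;
  wiener_independent_increments : forall s u, 0 <= s -> s < u ->
    independent (F s) (g_sigma_preimage (fun i => W i u \- W i s)) ;
  wiener_normal_increments : forall i s u, 0 <= s -> s < u ->
    forall B : set R, measurable B ->
      P ((W i u \- W i s) @^-1` B) = normal_prob 0 (Num.sqrt (u - s)) B ;
  wiener_continuous : forall i,
    {ae P, forall w, {within `[0, +oo[, continuous (fun s => W i s w)}} ;
  wiener_independent_components :
    mutually_independent (fun i => sigma_process (W i)) }.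

(* X_q, Y belong to L_2(Omega, P) and l.i.m. X_q = Y. *)
Definition mean_square_lim (X : nat -> Omega -> R) (Y : Omega -> R) : Prop :=
  [/\ forall q, X q \in Lfun P 2%:E, Y \in Lfun P 2%:E &
      (fun q => 'E_P[fun w => ((X q w - Y w) ^+ 2)%R]%E) @ \oo --> 0%E].

(* The process equal to [step_val k] on [step_time k, step_time k.+1[, for
   k < step_size. *)
Structure step_process := StepProcess {
  step_size : nat ;
  step_time : nat -> R ;
  step_val : nat -> Omega -> R }.

Definition step_fun (H : step_process) (s : R) (w : Omega) : R :=
  \sum_(k < step_size H)
    step_val H k w * \1_(`[step_time H k, step_time H k.+1[) s.

Definition step_ito (B : R -> Omega -> R) (H : step_process) (w : Omega) : R :=
  \sum_(k < step_size H)
    step_val H k w * (B (step_time H k.+1) w - B (step_time H k) w).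

Definition nonanticipating_step (F : R -> set (set Omega)) (t T : R)
    (H : step_process) : Prop :=
  [/\ step_time H 0 = t,
      step_time H (step_size H) = T,
      forall k, (k < step_size H)%N -> step_time H k < step_time H k.+1 &
      forall k, (k < step_size H)%N ->
        measurable_wrt (F (step_time H k)) (step_val H k) /\
        step_val H k \in Lfun P 2%:E].

Definition nonanticipating (F : R -> set (set Omega)) (t T : R)
    (f : R -> Omega -> R) : Prop :=
  [/\ measurable_fun (`[t, T] `*` setT)
        (fun z : measurableTypeR R * Omega => f z.1 z.2),
      forall s, s \in `[t, T] -> measurable_wrt (F s) (f s) &
      (\int[mu]_(s in `[t, T]) \int[P]_w ((f s w) ^+ 2)%:E < +oo)%E].

(* X is (a version of) the Ito integral of f over [t, T] against B; it is
   determined only up to almost sure equality. *)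
Definition is_ito (F : R -> set (set Omega)) (B : R -> Omega -> R) (t T : R)
    (f : R -> Omega -> R) (X : Omega -> R) : Prop :=
  nonanticipating F t T f /\
  exists H : nat -> step_process,
    [/\ forall n, nonanticipating_step F t T (H n),
        (fun n => \int[mu]_(s in `[t, T])
            \int[P]_w ((step_fun (H n) s w - f s w) ^+ 2)%:E)%E
          @ \oo --> 0%E &
        mean_square_lim (fun n => step_ito B (H n)) X].

(* X is (a version of) int_t^T int_t^s dB1_tau dB2_s. *)
Definition is_iterated_ito (F : R -> set (set Omega)) (B1 B2 : R -> Omega -> R)
    (t T : R) (X : Omega -> R) : Prop :=
  exists Y : R -> Omega -> R,
    (forall s, s \in `[t, T] -> is_ito F B1 t s (fun _ _ => 1) (Y s)) /\
    is_ito F B2 t T Y X.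

End stochastic.

(* Main.v *)
Require Import Defs.
From HB Require Import structures.
From mathcomp Require Import all_boot all_order all_algebra.
From mathcomp Require Import all_classical all_reals all_analysis.
From mathcomp Require Import measurable_realfun ring lra.

Set Implicit Arguments.
Unset Strict Implicit.
Unset Printing Implicit Defensive.

Import Order.TTheory GRing.Theory Num.Theory.
Import numFieldNormedType.Exports.

Local Open Scope classical_set_scope.
Local Open Scope ring_scope.

(** Formally, the error of a partial sum of the expansion is a single stochastic integral
    against the second component:

      sum_(j < q) xi_j eta_j - I2
        = int_t^T (sum_(j < q) Phi_j(s) xi_j - (w1_s - w1_t)) dw2_s,
      Phi_j(s) = int_t^s phi_j(x) dx.

    Its integrand anticipates the path of the first component, since each xi_j depends on that
    path up to time T. But the two components are independent, and conditionally on the first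
    one the integrand is nonrandom: Ito's isometry therefore extends to integrands that depend
    on the first component only ([ito_inc_pair_S], [ito_isometry]), and the second moment of
    the error is the integral over s of E (sum_(j < q) Phi_j(s) xi_j - (w1_s - w1_t))^2.

    For a fixed s, the variables xi_j and w1_s - w1_t are the Ito integrals of phi_j and of the
    indicator of the interval from t to s. By the isometry for nonrandom integrands
    ([wiener_isometry]) the xi_j are orthonormal and the Fourier coefficients of w1_s - w1_t
    along them are the Phi_j(s). The expectation above thus equals
    s - t - sum_(j < q) Phi_j(s)^2, the remainder in Parseval's identity for that indicator. It
    tends to 0 by completeness of the system and lies between 0 and T - t, so its integral over
    s tends to 0 by dominated convergence ([remainder_integral_cvg]).

    An Ito integral being a limit of integrals of step processes, the computation is carried out
    on step processes. The integrals xi_j and eta_j are approximated with nonrandom steps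
    ([ito_nonrandom]) and I2 with sums over uniform grids ([iterated_ito_grid]). Products of
    mean-square limits converge in mean only ([cvg_mul_mean]), and the bound on the second
    moment passes to the limit by lower semicontinuity ([sqr_integral_le_lim]). The resulting
    estimate, [expansion_error_le], has a factor 2 that comes from separating the approximation
    errors from the main term. *)

(** * Square-integrable functions *)

Section L2.
Context d (T : measurableType d) (R : realType).
Variables (mu : {measure set T -> \bar R}) (D : set T).
Hypothesis mD : measurable D.
Implicit Types (f g h : T -> R).

Definition sqi f : Prop :=
  measurable_fun D f /\ (\int[mu]_(x in D) ((f x) ^+ 2)%:E < +oo)%E.

Definition ip f g : R := \int[mu]_(x in D) (f x * g x).

Lemma sqi_integrable f : sqi f -> mu.-integrable D (EFin \o (fun x => f x ^+ 2)).
Proof.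
move=> [mf fi]; apply/integrableP; split.
  by apply/measurable_EFinP; apply: measurable_funX.
by under eq_integral do rewrite /= ger0_norm ?sqr_ge0//.
Qed.

Lemma sqi_mul f g : sqi f -> sqi g ->
  mu.-integrable D (EFin \o (fun x => f x * g x)).
Proof.
move=> sf sg.
have h : mu.-integrable D (EFin \o (fun x => f x ^+ 2 + g x ^+ 2)).
  have -> : EFin \o (fun x => f x ^+ 2 + g x ^+ 2) =
     (EFin \o (fun x => f x ^+ 2)) \+ (EFin \o (fun x => g x ^+ 2)).
    by apply/funext => x /=; rewrite EFinD.
  by apply: integrableD => //; apply: sqi_integrable.
apply: (le_integrable mD _ _ h).
  by apply/measurable_EFinP; apply: measurable_funM; [case: sf|case: sg].
move=> x _ /=; rewrite lee_fin [leRHS]ger0_norm ?addr_ge0 ?sqr_ge0//.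
rewrite ler_norml; apply/andP; split.
  have := sqr_ge0 (f x + g x); have := sqr_ge0 (f x); have := sqr_ge0 (g x).
  by move=> *; nra.
have := sqr_ge0 (f x - g x); have := sqr_ge0 (f x); have := sqr_ge0 (g x).
by move=> *; nra.
Qed.

Lemma integrable_sqi f : measurable_fun D f ->
  mu.-integrable D (EFin \o (fun x => f x ^+ 2)) -> sqi f.
Proof.
move=> mf /integrableP[_ fi]; split => //.
by move: fi; under eq_integral do rewrite /= ger0_norm ?sqr_ge0//.
Qed.

Lemma sqi0 : sqi 0.
Proof.
by split; [exact: measurable_cst|rewrite integral0_eq// => x _; rewrite expr0n].
Qed.

Lemma sqiZ (a : R) f : sqi f -> sqi (a *: f).
Proof.
move=> sf; apply: integrable_sqi.
  by apply: measurable_funM; [exact: measurable_cst|case: sf].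
have -> : EFin \o (fun x => (a *: f) x ^+ 2) =
   fun x => ((a ^+ 2)%:E * (f x ^+ 2)%:E)%E.
  by apply/funext => x /=; rewrite /GRing.scale /= exprMn EFinM.
by apply: integrableZl => //; apply: sqi_integrable.
Qed.

Lemma sqiD f g : sqi f -> sqi g -> sqi (f + g).
Proof.
move=> sf sg; apply: integrable_sqi.
  by apply: measurable_funD; [case: sf|case: sg].
have -> : EFin \o (fun x => (f + g) x ^+ 2) =
   (EFin \o (fun x => f x ^+ 2)) \+
   ((fun x => (2%:E * (f x * g x)%R%:E)%E) \+ (EFin \o (fun x => g x ^+ 2))).
  apply/funext => x /=; rewrite -EFinM -!EFinD; congr EFin.
  have -> : (f + g) x = f x + g x by [].
  by ring.
apply: integrableD => //; first exact: sqi_integrable.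
apply: integrableD => //; last exact: sqi_integrable.
by apply: integrableZl => //; apply: (sqi_mul sf sg).
Qed.

Lemma sqiN f : sqi f -> sqi (- f).
Proof. by rewrite -scaleN1r; apply: sqiZ. Qed.

Lemma sqiB f g : sqi f -> sqi g -> sqi (f - g).
Proof. by move=> sf sg; apply: sqiD => //; apply: sqiN. Qed.

Lemma sqi_sum (I : Type) (r : seq I) (Q : pred I) (F : I -> T -> R) :
  (forall i, Q i -> sqi (F i)) -> sqi (\sum_(i <- r | Q i) F i).
Proof. by move=> h; apply: big_ind => //; [exact: sqi0|exact: sqiD]. Qed.

Lemma ipC f g : ip f g = ip g f.
Proof. by apply: eq_Rintegral => x _; rewrite mulrC. Qed.

Lemma ipDl f g h : sqi f -> sqi g -> sqi h -> ip (f + g) h = ip f h + ip g h.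
Proof.
move=> sf sg sh; rewrite /ip -RintegralD//; [|exact: sqi_mul..].
by apply: eq_Rintegral => x _; rewrite -mulrDl.
Qed.

Lemma ipZl a f h : sqi f -> sqi h -> ip (a *: f) h = a * ip f h.
Proof.
move=> sf sh; rewrite /ip -RintegralZl//; last exact: sqi_mul.
by apply: eq_Rintegral => x _; rewrite mulrA.
Qed.

Lemma ipDr f g h : sqi f -> sqi g -> sqi h -> ip h (f + g) = ip h f + ip h g.
Proof. by move=> sf sg sh; rewrite ipC ipDl// !(ipC h). Qed.

Lemma ipZr a f h : sqi f -> sqi h -> ip h (a *: f) = a * ip h f.
Proof. by move=> sf sh; rewrite ipC ipZl// ipC. Qed.

Lemma ip0l h : ip 0 h = 0.
Proof.
rewrite /ip /Rintegral; under eq_integral do rewrite [0 _]/(0:R) mul0r.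
by rewrite integral0.
Qed.

Lemma ip_suml n (F : nat -> T -> R) h : (forall i, (i < n)%N -> sqi (F i)) -> sqi h ->
  ip (\sum_(i < n) F i) h = \sum_(i < n) ip (F i) h.
Proof.
move=> + sh; elim: n => [|n ih] sF; first by rewrite !big_ord0 ip0l.
rewrite !big_ord_recr /= ipDl ?ih//.
- by move=> i lin; apply: sF; apply: ltnW.
- by apply: sqi_sum => i _; apply/sF/leqW/ltn_ord.
- exact: sF.
Qed.

Lemma ip_sumr n (F : nat -> T -> R) h : (forall i, (i < n)%N -> sqi (F i)) -> sqi h ->
  ip h (\sum_(i < n) F i) = \sum_(i < n) ip h (F i).
Proof.
by move=> sF sh; rewrite ipC ip_suml//; apply: eq_bigr => i _; rewrite ipC.
Qed.

Lemma ip_ge0 f : 0 <= ip f f.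
Proof. by apply: Rintegral_ge0 => x _; rewrite -expr2 sqr_ge0. Qed.

Lemma ipE f : sqi f -> (ip f f)%:E = (\int[mu]_(x in D) (f x ^+ 2)%:E)%E.
Proof.
move=> sf; rewrite /ip /Rintegral fineK; last exact: integrable_fin_num (sqi_mul sf sf).
by under eq_integral do rewrite -expr2.
Qed.

Lemma ipNl f h : sqi f -> sqi h -> ip (- f) h = - ip f h.
Proof. by move=> sf sh; rewrite -scaleN1r ipZl// mulN1r. Qed.

Lemma ipNr f h : sqi f -> sqi h -> ip h (- f) = - ip h f.
Proof. by move=> sf sh; rewrite -scaleN1r ipZr// mulN1r. Qed.

Lemma ipBl f g h : sqi f -> sqi g -> sqi h -> ip (f - g) h = ip f h - ip g h.
Proof. by move=> sf sg sh; rewrite ipDl ?ipNl//; apply: sqiN. Qed.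

Lemma ipBr f g h : sqi f -> sqi g -> sqi h -> ip h (f - g) = ip h f - ip h g.
Proof. by move=> sf sg sh; rewrite ipDr ?ipNr//; apply: sqiN. Qed.

Lemma ip_sub_sq f g : sqi f -> sqi g ->
  ip (f - g) (f - g) = ip f f - 2 * ip f g + ip g g.
Proof.
move=> sf sg; rewrite ipBl ?ipBr//; last exact: sqiB.
by rewrite (ipC g f); ring.
Qed.

Lemma ip_add_sq f g : sqi f -> sqi g ->
  ip (f + g) (f + g) = ip f f + 2 * ip f g + ip g g.
Proof.
move=> sf sg; rewrite ipDl ?ipDr//; last exact: sqiD.
by rewrite (ipC g f); ring.
Qed.

Lemma ip_triangle f g : sqi f -> sqi g ->
  ip (f + g) (f + g) <= 2 * ip f f + 2 * ip g g.
Proof.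
move=> sf sg; have := ip_ge0 (f - g).
by rewrite ip_sub_sq// ip_add_sq// => ?; lra.
Qed.

Lemma ip_triangleB f g h : sqi f -> sqi g -> sqi h ->
  ip (f - g) (f - g) <= 2 * ip (f - h) (f - h) + 2 * ip (h - g) (h - g).
Proof.
move=> sf sg sh; rewrite -[f - g](subrKA h).
by apply: ip_triangle; apply: sqiB.
Qed.

Lemma ip_CS f g : sqi f -> sqi g -> ip f g ^+ 2 <= ip f f * ip g g.
Proof.
move=> sf sg.
have quad (a b : R) : 0 <= a ^+ 2 * ip f f - 2 * (a * b) * ip f g + b ^+ 2 * ip g g.
  have := ip_ge0 (a *: f - b *: g).
  rewrite ip_sub_sq; [|exact: sqiZ..].
  rewrite !ipZl ?ipZr//; [|exact: sqiZ..].
  by move=> h; apply: le_trans h _; rewrite le_eqVlt; apply/orP; left; apply/eqP; ring.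
have [g0|g0] := ltrP 0 (ip g g).
  have := quad (ip g g) (ip f g) => h.
  rewrite -subr_ge0 -(pmulr_rge0 _ g0).
  by apply: le_trans h _; rewrite le_eqVlt; apply/orP; left; apply/eqP; ring.
have gg0 : ip g g = 0 by apply/eqP; rewrite eq_le g0 ip_ge0.
rewrite gg0 mulr0.
have f0 := ip_ge0 f.
have [->|n0] := eqVneq (ip f g) 0; first by rewrite expr0n.
have := quad 1 ((ip f f + 1) / ip f g).
rewrite gg0 mulr0 addr0 mul1r -mulrA divfK// expr1n mul1r => ?; lra.
Qed.

Lemma ip_sum_le n (F : nat -> T -> R) : (forall i, (i < n)%N -> sqi (F i)) ->
  ip (\sum_(i < n) F i) (\sum_(i < n) F i) <= n%:R * \sum_(i < n) ip (F i) (F i).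
Proof.
move=> sF.
have sS : sqi (\sum_(i < n) F i) by apply: sqi_sum => i _; apply: sF.
rewrite ip_suml//.
have -> : n%:R * \sum_(i < n) ip (F i) (F i) =
    \sum_(i < n) \sum_(j < n) (ip (F i) (F i) / 2 + ip (F j) (F j) / 2).
  under [RHS]eq_bigr do rewrite big_split /= sumr_const card_ord -mulr_suml.
  rewrite big_split /= sumr_const card_ord sumrMnl -mulr_suml.
  by rewrite -mulrnDl -splitr mulr_natl.
apply: ler_sum => i _; rewrite ip_sumr//; last exact: sF.
apply: ler_sum => j _.
have := ip_ge0 (F i - F j); rewrite ip_sub_sq; [|exact: sF..].
by move=> ?; lra.
Qed.

(** By bilinearity and the Cauchy-Schwarz inequality. *)
Lemma cvg_ip (f_ g_ : nat -> T -> R) f g :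
  (forall n, sqi (f_ n)) -> (forall n, sqi (g_ n)) -> sqi f -> sqi g ->
  ip (f_ n - f) (f_ n - f) @[n --> \oo] --> 0 ->
  ip (g_ n - g) (g_ n - g) @[n --> \oo] --> 0 ->
  ip (f_ n) (g_ n) @[n --> \oo] --> ip f g.
Proof.
move=> sf_ sg_ sf sg cf cg.
have bnd a b : sqi a -> sqi b -> `|ip a b| <= Num.sqrt (ip a a * ip b b).
  move=> sa sb; rewrite -sqrtr_sqr ler_sqrt ?mulr_ge0 ?ip_ge0//.
  exact: ip_CS.
have sqrt0 (u v : nat -> R) : (forall n, `|v n| <= Num.sqrt (u n)) ->
    u n @[n --> \oo] --> 0 -> v n @[n --> \oo] --> 0.
  move=> vu u0; apply/norm_cvg0P; apply: (squeeze_cvgr (f := fun=> 0)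
    (h := fun n => Num.sqrt (u n))); last 1 first.
  - by have := cvg_comp _ _ u0 (@sqrt_continuous R 0); rewrite sqrtr0; apply.
  - by near=> n; rewrite normr_ge0 vu.
  - exact: cvg_cst.
have e n : ip (f_ n) (g_ n) = ip f g + (ip (f_ n - f) g +
   (ip f (g_ n - g) + ip (f_ n - f) (g_ n - g))).
  have sfn := sf_ n; have sgn := sg_ n.
  have := sqiB sfn sf; have := sqiB sgn sg => s1 s2.
  by rewrite (ipBl sfn sf sg) (ipBl sfn sf s1) !(ipBr sgn sg)//; ring.
have c1 : ip (f_ n - f) g @[n --> \oo] --> 0.
  apply: sqrt0 (fun n => bnd _ _ (sqiB (sf_ n) sf) sg) _.
  by have := cvgM cf (cvg_cst (ip g g)); rewrite mul0r; apply.
have c2 : ip f (g_ n - g) @[n --> \oo] --> 0.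
  apply: sqrt0 (fun n => bnd _ _ sf (sqiB (sg_ n) sg)) _.
  by have := cvgM (cvg_cst (ip f f)) cg; rewrite mulr0; apply.
have c3 : ip (f_ n - f) (g_ n - g) @[n --> \oo] --> 0.
  apply: sqrt0 (fun n => bnd _ _ (sqiB (sf_ n) sf) (sqiB (sg_ n) sg)) _.
  by have := cvgM cf cg; rewrite mulr0; apply.
have := cvgD (cvg_cst (ip f g)) (cvgD c1 (cvgD c2 c3)); rewrite !addr0.
by rewrite (eq_cvg _ _ e); apply.
Unshelve. all: by end_near.
Qed.

End L2.

Lemma ip_subC d (T : measurableType d) (R : realType) (mu : {measure set T -> \bar R})
    (D : set T) (f g : T -> R) : ip mu D (f - g) (f - g) = ip mu D (g - f) (g - f).
Proof. by apply: eq_Rintegral => x _; rewrite !(addrfctE, opprfctE); ring. Qed.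

Lemma prob_fin d (T : measurableType d) (R : realType) (P : probability T R) :
  (P setT < +oo)%E.
Proof. by rewrite probability_setT ltry. Qed.

Lemma sqi_cst d (T : measurableType d) (R : realType) (mu : {measure set T -> \bar R})
    (D : set T) (c : R) :
  measurable D -> (mu D < +oo)%E -> sqi mu D (cst c).
Proof.
move=> mD fD; split; first exact: measurable_cst.
by rewrite /cst integral_cst//= lte_mul_pinfty// ?lee_fin ?sqr_ge0.
Qed.

Lemma sqi_int d (T : measurableType d) (R : realType) (mu : {measure set T -> \bar R})
    (D : set T) (f : T -> R) :
  measurable D -> (mu D < +oo)%E -> sqi mu D f -> mu.-integrable D (EFin \o f).
Proof.
move=> mD fD sf; have := sqi_mul mD sf (sqi_cst 1 mD fD).
by apply: eq_integrable => // x _ /=; rewrite mulr1.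
Qed.

Lemma ip_norm d (T : measurableType d) (R : realType) (mu : {measure set T -> \bar R})
    (D : set T) (f : T -> R) : ip mu D (fun x => `|f x|) (fun x => `|f x|) = ip mu D f f.
Proof. by apply: eq_Rintegral => x _; rewrite -!expr2 real_normK ?num_real. Qed.

Lemma sqi_norm d (T : measurableType d) (R : realType) (mu : {measure set T -> \bar R})
    (D : set T) (f : T -> R) : measurable D -> sqi mu D f -> sqi mu D (fun x => `|f x|).
Proof.
move=> mD sf; apply: integrable_sqi; first by apply: measurableT_comp => //; case: sf.
have := sqi_integrable sf; apply: eq_integrable => // x _ /=.
by rewrite real_normK ?num_real.
Qed.

(** * Inequalities and limits for integrals *)

(** The integral of a nonnegative function is a supremum over the simple functions below it, so
    it is monotone without any measurability. This serves for second moments such as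
    E f(s, .)^2, as functions of the time s. *)
Lemma ge0_le_integral_nomeas d (T : measurableType d) (R : realType)
    (mu : {measure set T -> \bar R}) (D : set T) (f g : T -> \bar R) :
  (forall x, D x -> 0 <= f x)%E -> (forall x, D x -> f x <= g x)%E ->
  (\int[mu]_(x in D) f x <= \int[mu]_(x in D) g x)%E.
Proof.
move=> f0 fg.
rewrite ge0_integralE// ge0_integralE; last first.
  by move=> x Dx; apply: le_trans (fg x Dx); apply: f0.
apply: ereal_sup_le => _ [h hf <-]; exists h => //= x.
apply: le_trans (hf x) _; rewrite !patchE; case: ifPn => // /set_mem; exact: fg.
Qed.

Lemma ge0_le_integral_sub d (T : measurableType d) (R : realType)
    (mu : {measure set T -> \bar R}) (A B : set T) (f g : T -> \bar R) :
  A `<=` B -> (forall x, A x -> 0 <= f x)%E -> (forall x, A x -> f x <= g x)%E ->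
  (forall x, B x -> 0 <= g x)%E ->
  (\int[mu]_(x in A) f x <= \int[mu]_(x in B) g x)%E.
Proof.
move=> AB f0 fg g0; rewrite integral_mkcond (integral_mkcond B).
apply: ge0_le_integral_nomeas => x _; rewrite !patchE.
  by case: ifPn => // /set_mem /f0.
case: ifPn => [/set_mem Ax|_]; first by rewrite mem_set ?fg//; exact: AB.
by case: ifPn => // /set_mem /g0.
Qed.

Lemma sqi_subset d (T : measurableType d) (R : realType) (mu : {measure set T -> \bar R})
    (A B : set T) (f : T -> R) : measurable A -> measurable B -> A `<=` B ->
  sqi mu B f -> sqi mu A f.
Proof.
move=> mA mB AB [mf fi]; split; first exact: measurable_funS mf.
apply: le_lt_trans fi; apply: ge0_le_integral_sub => // x _;
  by rewrite lee_fin sqr_ge0.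
Qed.

(** An affine bound passes to integrals for arbitrary [g]: the measurable function
    [max 0 ((f - c) / C)] lies between 0 and [g]. *)
Lemma integral_le_affine d (T : measurableType d) (R : realType)
    (mu : {measure set T -> \bar R}) (D : set T) (f : T -> R) (g : T -> \bar R) (c C : R) :
  measurable D -> measurable_fun D f -> (forall x, 0 <= f x) -> 0 <= c -> 0 < C ->
  (forall x, D x -> 0 <= g x)%E ->
  (forall x, D x -> (f x)%:E <= c%:E + C%:E * g x)%E ->
  (\int[mu]_(x in D) (f x)%:E <= c%:E * mu D + C%:E * \int[mu]_(x in D) g x)%E.
Proof.
move=> mD mf f0 c0 C0 g0 fg.
pose h x := Num.max ((f x - c) / C) 0.
have mh : measurable_fun D h.
  apply: measurable_maxr; last exact: measurable_cst.
  apply: measurable_funM; last exact: measurable_cst.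
  by apply: measurable_funB => //; exact: measurable_cst.
have h0 x : 0 <= h x by rewrite le_max lexx orbT.
have hg x : D x -> ((h x)%:E <= g x)%E.
  move=> Dx; have := g0 x Dx; have := fg x Dx; case: (g x) => [r| |];
    [|by move=> *; rewrite leey|by []].
  rewrite -EFinM -EFinD !lee_fin => fr r0.
  by rewrite ge_max r0 andbT ler_pdivrMr// lerBlDl mulrC.
apply: (@le_trans _ _ (\int[mu]_(x in D) (c%:E + C%:E * (h x)%:E))%E).
  apply: ge0_le_integral_nomeas => x Dx; first by rewrite lee_fin.
  rewrite -EFinM -EFinD lee_fin -lerBlDl.
  by rewrite mulrC -ler_pdivrMr// /h le_max lexx.
rewrite ge0_integralD//; last 2 first.
- by move=> x _; rewrite -EFinM lee_fin mulr_ge0// ltW.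
- by apply: measurable_funeM; apply/measurable_EFinP.
rewrite integral_cst//; apply: leeD => //.
rewrite (ge0_integralZl_EFin mu mD _ _ (ltW C0)); last 2 first.
- by move=> x _; rewrite lee_fin.
- by apply/measurable_EFinP.
apply: lee_wpmul2l; first by rewrite lee_fin ltW.
by apply: ge0_le_integral_nomeas => x Dx; [rewrite lee_fin|exact: hg].
Qed.

Lemma EFin_Rintegral d (T : measurableType d) (R : realType) (mu : {measure set T -> \bar R})
    (D : set T) (f : T -> R) : measurable D -> mu.-integrable D (EFin \o f) ->
  (\int[mu]_(x in D) f x)%:E = (\int[mu]_(x in D) (f x)%:E)%E.
Proof. by move=> mD fi; rewrite /Rintegral fineK//; exact: integrable_fin_num. Qed.

Lemma Rintegral_sum d' (X : measurableType d') (R : realType) (nu : {measure set X -> \bar R}) (E : set X)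
    n (f : nat -> X -> R) : measurable E ->
  (forall k, (k < n)%N -> nu.-integrable E (EFin \o f k)) ->
  nu.-integrable E (EFin \o (fun x => \sum_(k < n) f k x)) /\
  \int[nu]_(x in E) (\sum_(k < n) f k x) = \sum_(k < n) \int[nu]_(x in E) f k x.
Proof.
move=> mE; elim: n => [|n ih] h.
  split; last first.
    by under eq_Rintegral do rewrite big_ord0; rewrite big_ord0 Rintegral_cst// mul0r.
    rewrite (_ : EFin \o _ = cst 0%E); first exact: integrable0.
    by apply/funext => x /=; rewrite big_ord0.
have [|i1 e1] := ih; first by move=> k kn; apply: h; exact: leqW.
have hn := h n (ltnSn n).
split.
  have := integrableD mE i1 hn; apply: eq_integrable => // x _ /=.
  by rewrite big_ord_recr.
under eq_Rintegral do rewrite big_ord_recr/=.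
by rewrite RintegralD// e1 big_ord_recr.
Qed.

Lemma cvg0Z (R : realType) (a : R) (u : nat -> R) :
  u n @[n --> \oo] --> 0 -> a * u n @[n --> \oo] --> 0.
Proof. by move=> u0; rewrite -[X in _ --> X](mulr0 a); apply: cvgM => //; exact: cvg_cst. Qed.

Lemma cvg0D (R : realType) (u v : nat -> R) :
  u n @[n --> \oo] --> 0 -> v n @[n --> \oo] --> 0 -> u n + v n @[n --> \oo] --> 0.
Proof. by move=> u0 v0; rewrite -[X in _ --> X](addr0 0); apply: cvgD. Qed.

Lemma cvg0_sum (R : realType) (q : nat) (u : nat -> nat -> R) :
  (forall j, u j n @[n --> \oo] --> 0) -> \sum_(j < q) u j n @[n --> \oo] --> 0.
Proof.
move=> h; elim: q => [|q ih].
  by under eq_cvg do rewrite big_ord0; exact: cvg_cst.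
by under eq_cvg do rewrite big_ord_recr /=; exact: cvg0D.
Qed.

Lemma cvg0_le_EFin (R : realType) (u : nat -> R) (v : nat -> \bar R) :
  (forall n, 0 <= u n) -> (forall n, ((u n)%:E <= v n)%E) -> v n @[n --> \oo] --> 0%E ->
  u n @[n --> \oo] --> 0.
Proof.
move=> u0 uv v0.
have h : (u n)%:E @[n --> \oo] --> 0%E.
  apply: (squeeze_cvge (f := cst 0%E) (h := v)) => //; last exact: cvg_cst.
  by apply: nearW => n; rewrite lee_fin u0 uv.
exact: (fine_cvg h).
Qed.

Lemma cvg0_le (R : realType) (u v : nat -> R) :
  (forall n, 0 <= u n) -> (forall n, u n <= v n) -> v n @[n --> \oo] --> 0 ->
  u n @[n --> \oo] --> 0.
Proof.
move=> u0 uv v0; apply: (squeeze_cvgr (f := cst 0) (h := v)) => //; last exact: cvg_cst.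
by apply: nearW => n; rewrite u0 uv.
Qed.

(** The mean-square norm is lower semicontinuous for convergence in mean. Truncation at height
    [M] makes the square Lipschitz with constant [2 * M], so that the bound passes to the limit
    for the truncated square; [M] then tends to infinity by monotone convergence. *)
Lemma sqr_integral_le_lim d (T : measurableType d) (R : realType)
    (mu : {measure set T -> \bar R}) (X_ : nat -> T -> R) (X : T -> R)
    (c_ delta : nat -> R) (c : R) :
  (forall n, measurable_fun setT (X_ n)) -> measurable_fun setT X ->
  (forall n, (\int[mu]_x (X_ n x ^+ 2)%:E <= (c_ n)%:E)%E) ->
  (forall n, (\int[mu]_x `|X_ n x - X x|%:E <= (delta n)%:E)%E) ->
  c_ n @[n --> \oo] --> c -> delta n @[n --> \oo] --> 0 ->
  (\int[mu]_x (X x ^+ 2)%:E <= c%:E)%E.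
Proof.
move=> mX_ mX hc hd cc cd.
pose g (M : nat) x : R := Num.min (X x ^+ 2) (M%:R ^+ 2).
have mg M : measurable_fun setT (g M).
  by apply: measurable_minr => //; apply: measurable_funX.
have g0 M x : 0 <= g M x by rewrite le_min !sqr_ge0.
have trunc (M x y : R) : 0 <= M -> Num.min (x ^+ 2) (M ^+ 2) <= y ^+ 2 + 2 * M * `|y - x|.
  move=> M0.
  have h0 := lerB_dist x y; rewrite distrC in h0.
  have hx := normr_ge0 x; have hy := normr_ge0 y; have he := normr_ge0 (y - x).
  rewrite -(real_normK (num_real x)) -(real_normK (num_real y)).
  move: h0 hx hy he; move: (`|x|) (`|y|) (`|y - x|) => a b e h0 hx hy he.
  have Me : 0 <= 2 * M * e by rewrite !mulr_ge0.
  rewrite ge_min; have [aM|Ma] := leP a M; apply/orP; [left|right].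
    have [ab|ba] := leP a b.
      by rewrite (@le_trans _ _ (b ^+ 2)) ?lerDl// ler_pXn2r ?nnegrE.
    have := @ler_pM _ (a - b) e (a + b) (2 * M); rewrite subr_ge0 addr_ge0// ltW//.
    by move=> /(_ isT isT h0 ltac:(lra)) => ?; nra.
  have [Mb|bM] := leP M b.
    by rewrite (@le_trans _ _ (b ^+ 2)) ?lerDl// ler_pXn2r ?nnegrE.
  have := @ler_pM _ (M - b) e (M + b) (2 * M); rewrite subr_ge0 addr_ge0// ltW//.
  by move=> /(_ isT isT ltac:(lra) ltac:(lra)) => ?; nra.
have hM M : (\int[mu]_x (g M x)%:E <= c%:E)%E.
  have hn n : (\int[mu]_x (g M x)%:E <= (c_ n + 2 * M%:R * delta n)%:E)%E.
    apply: (@le_trans _ _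
      (\int[mu]_x ((X_ n x ^+ 2)%:E + (2 * M%:R)%:E * `|X_ n x - X x|%:E))%E).
      apply: ge0_le_integral_nomeas => x _; first by rewrite lee_fin.
      by rewrite -EFinM -EFinD lee_fin; apply: trunc.
    have m1 : measurable_fun setT (fun x => `|X_ n x - X x|%:E).
      by apply/measurable_EFinP; apply: measurableT_comp => //; exact: measurable_funB.
    rewrite ge0_integralD//; last 3 first.
    - by move=> x _; rewrite lee_fin sqr_ge0.
    - by apply/measurable_EFinP; apply: measurable_funX.
    - exact: measurable_funeM.
    rewrite ge0_integralZl_EFin//.
    rewrite EFinD; apply: leeD => //; rewrite (EFinM _ (delta n)).
    by apply: lee_wpmul2l => //; rewrite lee_fin mulr_ge0.
  have hl : (c_ n + 2 * M%:R * delta n) @[n --> \oo] --> c.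
    rewrite -[X in _ --> X]addr0; apply: cvgD => //.
    exact: cvg0Z.
  have fin : (\int[mu]_x (g M x)%:E)%E \is a fin_num.
    rewrite ge0_fin_numE ?(le_lt_trans (hn 0%N)) ?ltry//.
    by apply: integral_ge0 => x _; rewrite lee_fin.
  rewrite -(fineK fin) lee_fin; apply: (cvgr_to_ge hl).
  by near=> n; rewrite -lee_fin fineK.
have mono x : {homo (fun M => (g M x)%:E) : n m / (n <= m)%N >-> (n <= m)%E}.
  move=> n m nm; rewrite lee_fin /g le_min ge_min lexx /= ge_min; apply/orP; right.
  by rewrite ler_pXn2r ?nnegrE// ler_nat.
have lg x : (g M x)%:E @[M --> \oo] --> (X x ^+ 2)%:E.
  apply: cvg_near_cst; near=> M; congr EFin; rewrite /g min_l//.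
  rewrite -(real_normK (num_real (X x))) ler_pXn2r ?nnegrE//.
  by near: M; exact: nbhs_infty_ger.
have -> : (\int[mu]_x (X x ^+ 2)%:E = \int[mu]_x limn (fun M => (g M x)%:E))%E.
  by apply: eq_integral => x _; apply/esym/cvg_lim => //.
rewrite monotone_convergence//; last 2 first.
- by move=> M; apply/measurable_EFinP.
- by move=> M x _; rewrite lee_fin.
apply: lime_le; last by apply: nearW => M; exact: hM.
apply: ereal_nondecreasing_is_cvgn => m n mn.
by apply: ge0_le_integral_nomeas => x _; [rewrite lee_fin|apply: mono].
Unshelve. all: by end_near.
Qed.

(** Products of mean-square limits are limits in mean, by the Cauchy-Schwarz inequality applied
    to [(f_ n - f) * g_ n] and [f * (g_ n - g)]. *)
Lemma cvg_mul_mean d (T : measurableType d) (R : realType) (mu : {measure set T -> \bar R})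
    (D : set T) (f_ g_ : nat -> T -> R) (f g : T -> R) : measurable D ->
  (forall n, sqi mu D (f_ n)) -> (forall n, sqi mu D (g_ n)) -> sqi mu D f -> sqi mu D g ->
  ip mu D (f_ n - f) (f_ n - f) @[n --> \oo] --> 0 ->
  ip mu D (g_ n - g) (g_ n - g) @[n --> \oo] --> 0 ->
  exists2 delta : nat -> R,
    (forall n, (\int[mu]_(x in D) `|f_ n x * g_ n x - f x * g x|%:E <= (delta n)%:E)%E) &
    delta n @[n --> \oo] --> 0.
Proof.
move=> mD sf_ sg_ sf sg cf cg.
pose a n x : R := `|(f_ n - f) x|; pose b n x : R := `|(g_ n - g) x|.
pose f' x : R := `|f x|; pose g' n x : R := `|g_ n x|; pose g1 x : R := `|g x|.
have sa n : sqi mu D (a n) by apply: sqi_norm => //; exact: sqiB.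
have sb n : sqi mu D (b n) by apply: sqi_norm => //; exact: sqiB.
have sf' : sqi mu D f' by exact: sqi_norm.
have sg' n : sqi mu D (g' n) by exact: sqi_norm.
have sg1 : sqi mu D g1 by exact: sqi_norm.
have s0 := sqi0 mu D.
have ca : ip mu D (a n - 0) (a n - 0) @[n --> \oo] --> 0.
  by under eq_cvg do rewrite subr0 ip_norm.
have cb : ip mu D (b n - 0) (b n - 0) @[n --> \oo] --> 0.
  by under eq_cvg do rewrite subr0 ip_norm.
have cg' : ip mu D (g' n - g1) (g' n - g1) @[n --> \oo] --> 0.
  apply: (cvg0_le _ _ cg) => n; first exact: ip_ge0.
  apply: le_Rintegral => //; [by apply: sqi_mul => //; exact: sqiB..|].
  move=> x _; rewrite -!expr2 -real_normK ?num_real// -[leRHS]real_normK ?num_real//.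
  by rewrite ler_pXn2r ?nnegrE//; exact: ler_dist_dist.
have cf' : ip mu D (f' - f') (f' - f') @[n --> \oo] --> 0.
  by rewrite subrr ip0l; exact: cvg_cst.
have c1 := cvg_ip mD sa sg' s0 sg1 ca cg'.
have c2 := cvg_ip mD (fun=> sf') sb sf' s0 cf' cb.
rewrite ip0l in c1; rewrite ipC ip0l in c2.
exists (fun n => ip mu D (a n) (g' n) + ip mu D f' (b n)); last exact: cvg0D.
move=> n; rewrite EFinD !EFin_Rintegral//; [|exact: sqi_mul..].
rewrite -ge0_integralD//; last 4 first.
- by move=> x _; rewrite lee_fin; apply: mulr_ge0; exact: normr_ge0.
- have := sqi_mul mD (sa n) (sg' n); exact: measurable_int.
- by move=> x _; rewrite lee_fin; apply: mulr_ge0; exact: normr_ge0.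
- have := sqi_mul mD sf' (sb n); exact: measurable_int.
apply: ge0_le_integral_nomeas => x _; first by rewrite lee_fin.
rewrite -EFinD lee_fin -!normrM.
have -> : f_ n x * g_ n x - f x * g x = (f_ n - f) x * g_ n x + f x * (g_ n - g) x.
  by rewrite !addrfctE !opprfctE; ring.
exact: ler_normD.
Qed.

(** * Mean-square convergence of random variables *)

Lemma Rintegral_prob_cst d (T : measurableType d) (R : realType) (P : probability T R)
  (c : R) : \int[P]_w c = c.
Proof.
rewrite Rintegral_cst// (_ : fine _ = 1) ?mulr1//.
exact: (congr1 fine (probability_setT P)).
Qed.

Lemma sqi_Lfun d (T : measurableType d) (R : realType) (P : probability T R) (X : T -> R) :
  X \in Lfun P 2%:E <-> sqi P setT X.
Proof.
split=> [h|[mX iX]].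
  apply: integrable_sqi; last exact: Lfun2_integrable_sqr.
  by move: h; rewrite inE => /andP[/[!inE]].
rewrite inE; apply/andP; split; rewrite inE//=.
rewrite /finite_norm unlock /Lnorm poweR_lty//.
apply: le_lt_trans iX; rewrite le_eqVlt; apply/orP; left; apply/eqP.
by apply: eq_integral => x _ /=; rewrite -(real_normK (num_real (X x))) -powR_mulrn.
Qed.

Lemma mean_square_limP d (T : measurableType d) (R : realType) (P : probability T R)
    (X : nat -> T -> R) (Y : T -> R) :
  mean_square_lim P X Y <-> [/\ forall q, sqi P setT (X q), sqi P setT Y &
    ip P setT (X q - Y) (X q - Y) @[q --> \oo] --> 0].
Proof.
have e q : sqi P setT (X q) -> sqi P setT Y ->
    ('E_P[fun w => ((X q w - Y w) ^+ 2)%R] = (ip P setT (X q - Y) (X q - Y))%:E)%E.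
  by move=> sX sY; rewrite unlock ipE//; exact: sqiB.
split=> -[h1 h2 h3].
  have sX q : sqi P setT (X q) by exact/sqi_Lfun.
  have sY : sqi P setT Y by exact/sqi_Lfun.
  split => //; apply: (cvg0_le_EFin _ _ h3) => n; first exact: ip_ge0.
  by rewrite e.
split; [by move=> q; exact/sqi_Lfun|exact/sqi_Lfun|].
rewrite (_ : (fun q => _) = (fun q => (ip P setT (X q - Y) (X q - Y))%:E)).
  by apply: cvg_EFin => //; exact: nearW.
by apply/funext => q; rewrite e.
Qed.

(** Pythagoras: [Z - m] is centered, hence orthogonal to constants. *)
Lemma mean_best d (T : measurableType d) (R : realType) (P : probability T R) (Z : T -> R)
    (c : R) : sqi P setT Z ->
  let m := ip P setT Z (cst 1) in
  ip P setT (Z - cst m) (Z - cst m) + (m - c) ^+ 2 = ip P setT (Z - cst c) (Z - cst c).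
Proof.
move=> sZ m; have mT := @measurableT _ T.
have s1 : sqi P setT (cst 1 : T -> R) := sqi_cst 1 mT (prob_fin P).
have ce (x : R) : cst x = x *: (cst 1 : T -> R).
  by apply/funext => w; exact: (esym (mulr1 x)).
have i1 : ip P setT (cst 1) (cst 1) = 1.
  by rewrite /ip; under eq_Rintegral do rewrite mul1r; exact: Rintegral_prob_cst.
have h (x : R) : ip P setT (Z - cst x) (Z - cst x) = ip P setT Z Z - 2 * (x * m) + x ^+ 2.
  rewrite ce (ip_sub_sq mT sZ (sqiZ mT x s1)) (ipZr mT _ s1 sZ).
  rewrite (ipZl mT _ s1 (sqiZ mT x s1)) (ipZr mT _ s1 s1) i1 -/m; ring.
by rewrite !h; ring.
Qed.

(** * Orthonormal systems *)

Section orthonormal.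
Context d (T : measurableType d) (R : realType).
Variables (mu : {measure set T -> \bar R}) (D : set T).
Hypothesis mD : measurable D.
Variables (phi : nat -> T -> R) (f : T -> R).
Hypotheses (sphi : forall j, sqi mu D (phi j)) (sf : sqi mu D f).
Hypothesis orth : forall j k, ip mu D (phi j) (phi k) = (j == k)%:R.

Lemma ip_orthonormal_sub n (c : nat -> R) :
  let g := f - \sum_(j < n) c j *: phi j in
  ip mu D g g = ip mu D f f - \sum_(j < n) ip mu D (phi j) f ^+ 2 +
    \sum_(j < n) (c j - ip mu D (phi j) f) ^+ 2.
Proof.
move=> g; rewrite {}/g.
have sc j : sqi mu D (c j *: phi j) by exact: sqiZ.
have sS : sqi mu D (\sum_(j < n) c j *: phi j) by exact: sqi_sum.
rewrite ip_sub_sq//.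
have -> : ip mu D f (\sum_(j < n) c j *: phi j) = \sum_(j < n) c j * ip mu D (phi j) f.
  rewrite (ip_sumr mD (F := fun j => c j *: phi j))//.
  by apply: eq_bigr => j _; rewrite ipZr// ipC.
have -> : ip mu D (\sum_(j < n) c j *: phi j) (\sum_(j < n) c j *: phi j) =
    \sum_(j < n) c j ^+ 2.
  rewrite (ip_suml mD (F := fun j => c j *: phi j))//; apply: eq_bigr => j _.
  rewrite (ip_sumr mD (F := fun j => c j *: phi j))// (bigD1 j)//= big1 => [|k kj].
    by rewrite ipZl// ipZr// orth eqxx mulr1 addr0 expr2.
  rewrite ipZl// ipZr// orth (_ : _ == _ = false) ?mulr0//.
  by apply/negbTE; rewrite eq_sym; apply: contra kj => /eqP e; apply/eqP/val_inj.
rewrite -!addrA; congr (_ + _).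
rewrite mulr_sumr -!sumrN -!big_split /=; apply: eq_bigr => j _; ring.
Qed.

Lemma bessel n : 0 <= ip mu D f f - \sum_(j < n) ip mu D (phi j) f ^+ 2.
Proof.
have := ip_orthonormal_sub n (fun j => ip mu D (phi j) f).
rewrite /= [X in _ = _ + X]big1 ?addr0 => [<-|j _]; first exact: ip_ge0.
by rewrite subrr expr0n.
Qed.

(** Parseval: a partial Fourier sum is the best approximation of [f] by the functions that it
    involves, so density gives its convergence. *)
Lemma parseval :
  (forall e : R, 0 < e -> exists n (c : nat -> R),
    let g := f - \sum_(j < n) c j *: phi j in ip mu D g g < e) ->
  ip mu D f f - \sum_(j < n) ip mu D (phi j) f ^+ 2 @[n --> \oo] --> 0.
Proof.
move=> dense; apply/cvgrPdist_lt => e e0.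
have [N [c]] := dense e e0; rewrite /= ip_orthonormal_sub => h.
near=> n; rewrite sub0r normrN ger0_norm; last exact: bessel.
apply: le_lt_trans h.
rewrite -addrA lerD2l -[leLHS]addr0; apply: lerD; last by apply: sumr_ge0 => j _; exact: sqr_ge0.
rewrite lerN2.
have Nn : (N <= n)%N by near: n; exact: nbhs_infty_ge.
rewrite -!(big_mkord xpredT (fun j => ip mu D (phi j) f ^+ 2)) (big_cat_nat _ Nn)//=.
by rewrite lerDl sumr_ge0// => j _; exact: sqr_ge0.
Unshelve. all: by end_near. Qed.

End orthonormal.

(** * Independent random variables *)

Definition indep_rv d (T : measurableType d) (R : realType) (P : probability T R)
    (X Y : T -> R) : Prop :=
  forall A B : set R, measurable A -> measurable B ->
  P (X @^-1` A `&` Y @^-1` B) = (P (X @^-1` A) * P (Y @^-1` B))%E.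

Section independence.
Context d (T : measurableType d) (R : realType) (P : probability T R).
Variables (X Y : T -> R).
Hypotheses (mX : measurable_fun setT X) (mY : measurable_fun setT Y).
Hypothesis indXY : indep_rv P X Y.

Let X' : {RV P >-> R} := HB.pack X (isMeasurableFun.Build _ _ _ _ _ mX).
Let Y' : {RV P >-> R} := HB.pack Y (isMeasurableFun.Build _ _ _ _ _ mY).
Let XY w := (X w, Y w).
Let mXY : measurable_fun setT XY.
Proof. exact: measurable_fun_pair. Qed.
Let XY' : {RV P >-> (R * R)%type} := HB.pack XY (isMeasurableFun.Build _ _ _ _ _ mXY).

Let joint S : measurable S ->
  (distribution P X' \x distribution P Y')%E S = distribution P XY' S.
Proof.
by move=> mS; apply: product_measure_unique.
Qed.

Let mmul : measurable_fun setT (fun z : R * R => (z.1 * z.2)%:E).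
Proof.
apply/measurable_EFinP; apply: measurable_funM; [exact: measurable_fst|exact: measurable_snd].
Qed.

Lemma indep_integrableM : P.-integrable setT (EFin \o X) -> P.-integrable setT (EFin \o Y) ->
  P.-integrable setT (EFin \o (fun w => X w * Y w)).
Proof.
move=> iX iY; apply/integrableP; split.
  by apply/measurable_EFinP; exact: measurable_funM.
have -> : (\int[P]_x `|(EFin \o (fun w => (X w * Y w)%R)) x| =
    \int[distribution P XY']_z `|(z.1 * z.2)%:E|)%E.
  rewrite ge0_integral_distribution//; exact: measurableT_comp.
rewrite (eq_measure_integral (distribution P X' \x distribution P Y')%E); last first.
  by move=> A mA _; exact/esym/joint.
rewrite fubini_tonelli1//; last exact: measurableT_comp.
rewrite /fubini_F /=.
have e x : (\int[distribution P Y']_y (`|x * y|)%:E = `|x|%:E * \int[P]_w `|Y w|%:E)%E.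
  rewrite ge0_integral_distribution//; last first.
    by apply/measurable_EFinP; apply: measurableT_comp => //; apply: measurable_funM.
  under eq_integral do rewrite /= normrM EFinM.
  rewrite ge0_integralZl_EFin//.
  by apply/measurable_EFinP; apply: measurableT_comp.
under eq_integral do rewrite e.
rewrite (@ge0_integral_distribution _ _ _ _ _ P X' (fun x => (`|x|%:E * \int[P]_w `|Y w|%:E)%E)); last 2 first.
- apply: emeasurable_funM => //.
  by apply/measurable_EFinP; exact: normr_measurable.
- by move=> y; rewrite mule_ge0// integral_ge0.
rewrite /=.
have [_ iX'] := integrableP _ _ _ iX; have [_ iY'] := integrableP _ _ _ iY.
rewrite ge0_integralZr//; last 2 first.
- by apply/measurable_EFinP; apply: measurableT_comp.
- exact: integral_ge0.
by apply: lte_mul_pinfty => //; [exact: integral_ge0|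
  rewrite ge0_fin_numE//; exact: integral_ge0].
Qed.

(** Under independence the joint law is the product of the laws, so that this is Fubini's
    theorem. *)
Lemma indep_expectationM : P.-integrable setT (EFin \o X) -> P.-integrable setT (EFin \o Y) ->
  \int[P]_w (X w * Y w) = (\int[P]_w X w) * (\int[P]_w Y w).
Proof.
move=> iX iY; have iXY := indep_integrableM iX iY.
have iD : (distribution P XY').-integrable setT (fun z : R * R => (z.1 * z.2)%:E).
  exact: (integrable_pushforward mXY (D := setT) mmul).
have iD' : (distribution P X' \x distribution P Y')%E.-integrable setT
    (fun z : R * R => (z.1 * z.2)%:E).
  have [m1 i1] := integrableP _ _ _ iD; apply/integrableP; split => //.
  by rewrite (eq_measure_integral (distribution P XY'))// => A mA _; exact: joint.
have h : (\int[P]_w (X w * Y w)%:E = (\int[P]_w (X w)%:E) * (\int[P]_w (Y w)%:E))%E.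
  have -> : (\int[P]_x (X x * Y x)%:E =
      \int[distribution P XY']_z (z.1 * z.2)%:E)%E.
    by rewrite integral_distribution.
  rewrite (eq_measure_integral (distribution P X' \x distribution P Y')%E); last first.
    by move=> A mA _; exact/esym/joint.
  rewrite -integral12_prod_meas1// /fubini_F/=.
  have mid : measurable_fun setT (fun y : R => y%:E).
    by apply/measurable_EFinP; exact: measurable_id.
  have iY' : (distribution P Y').-integrable setT (fun y => y%:E).
    exact: (integrable_pushforward mY (D := setT)).
  have iX' : (distribution P X').-integrable setT (fun y => y%:E).
    exact: (integrable_pushforward mX (D := setT)).
  have e x : (\int[distribution P Y']_y (x * y)%:E = x%:E * \int[P]_w (Y w)%:E)%E.
    under eq_integral do rewrite EFinM.
    by rewrite integralZl// integral_distribution.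
  under eq_integral do rewrite e.
  rewrite -(fineK (integrable_fin_num measurableT iY)) integralZr//.
  by rewrite (@integral_distribution _ _ _ _ _ P X' (fun y => y%:E)).
rewrite {1}/Rintegral h fineM//; exact: integrable_fin_num.
Qed.

End independence.

(** * Moments of the normal law *)

Section gaussian_moments.
Context {R : realType}.
Local Notation mu := (@lebesgue_measure R).
Variable sigma : R.
Hypothesis s0 : 0 < sigma.
Let p : R -> R := normal_pdf 0 sigma.

Let sn0 : sigma != 0. Proof. by rewrite gt_eqF. Qed.

Let pE x : p x = normal_peak sigma * expR (- x ^+ 2 / (sigma ^+ 2 *+ 2)).
Proof. by rewrite /p normal_pdfE// /normal_fun subr0. Qed.

Let p0 x : 0 <= p x. Proof. exact: normal_pdf_ge0. Qed.

Let pN x : p (- x) = p x. Proof. by rewrite !pE sqrrN. Qed.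

Let cp : continuous p. Proof. exact: continuous_normal_pdf. Qed.

Let mp D : measurable_fun D p.
Proof. by apply: measurable_funTS; exact: measurable_normal_pdf. Qed.

Let dp (x : R) : is_derive x (1:R) (fun y => - sigma ^+ 2 * p y) (x * p x).
Proof.
have -> : (fun y => - sigma ^+ 2 * p y) = (fun y => (- sigma ^+ 2 * normal_peak sigma) *:
    expR ((- (sigma ^+ 2 *+ 2)^-1) *: (y ^+ 2))).
  by apply/funext => y; rewrite pE mulrA; congr (_ * expR _); rewrite !mulNr [_ / _]mulrC -mulNr.
apply: is_derive_eq.
rewrite pE /GRing.scale/= mulr1 [- x ^+ 2 / _]mulrC mulrN -mulNr.
by field.
Qed.

(** By parts: [x * p x] is the derivative of [- sigma ^+ 2 * p]. *)
Let partial n : (0 < n)%N -> (\int[mu]_(x in `[0%R, n%:R]) (x ^+ 2 * p x)%:E =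
  (- sigma ^+ 2 * (n%:R * p n%:R))%:E + (sigma ^+ 2)%:E * \int[mu]_(x in `[0%R, n%:R]) (p x)%:E)%E.
Proof.
move=> n0.
have n0' : (0 : R) < n%:R by rewrite ltr0n.
under eq_integral do rewrite expr2 -mulrA.
have cc (f : R -> R) : continuous f -> {within `[0, n%:R], continuous f}.
  by move=> cf; apply: continuous_subspaceT.
have dd (f : R -> R) : (forall x, derivable f x 1) -> derivable_oo_LRcontinuous f 0 n%:R.
  move=> df; have cf x : {for x, continuous f}.
    by apply: differentiable_continuous; apply/derivable1_diffP.
  split; [by move=> *|exact/cvg_at_right_filter/cf|exact/cvg_at_left_filter/cf].
rewrite (@integration_by_parts R id (fun y => - sigma ^+ 2 * p y) (cst 1) (fun x => x * p x)) //; last 6 first.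
- by apply: cc => x; exact: cvg_cst.
- by apply: dd => x; exact: derivable_id.
- by move=> x _; rewrite derive1E derive_id.
- by apply: cc => x; apply: cvgM; [exact: cvg_id|exact: cp].
- by apply: dd => x; have := dp x.
- by move=> x _; rewrite derive1E; apply: derive_val.
rewrite mul0r subr0 mulrCA; congr (_ + _)%E.
under eq_integral do rewrite /= mul1r mulNr EFinN.
rewrite integral_ge0N; last by move=> x _; rewrite lee_fin mulr_ge0 ?sqr_ge0.
rewrite oppeK; under eq_integral do rewrite EFinM.
rewrite ge0_integralZl_EFin ?sqr_ge0//; first by move=> x _; rewrite lee_fin.
by apply/measurable_EFinP; exact: mp.
Qed.

Let tail0 : n%:R * p n%:R @[n --> \oo] --> 0.
Proof.
pose c := normal_peak sigma * (sigma ^+ 2 *+ 2).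
have c0 : 0 <= c by rewrite mulr_ge0 ?normal_peak_ge0// mulrn_wge0 ?sqr_ge0.
rewrite -cvg_shiftS.
apply: (squeeze_cvgr (f := fun=> 0) (h := fun n => c * n.+1%:R^-1)); last 2 first.
- exact: cvg_cst.
- by apply: cvg0Z; exact: cvg_harmonic.
apply: nearW => m; set n := m.+1; rewrite mulr_ge0//=.
have n0 : (0 : R) < n%:R by rewrite ltr0n.
rewrite pE /c mulrCA -mulrA ler_wpM2l ?normal_peak_ge0//.
have s2 : 0 < sigma ^+ 2 *+ 2 by rewrite mulrn_wgt0// exprn_gt0.
set y := (n%:R ^+ 2 / (sigma ^+ 2 *+ 2)); rewrite mulNr -/y expRN.
have y0 : 0 < y by rewrite divr_gt0// exprn_gt0.
have : y < expR y by apply: lt_le_trans (expR_ge1Dx y); rewrite ltrDr.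
move=> /ltW ye; rewrite -[leLHS]mulrC ler_pdivrMl ?expR_gt0//.
apply: le_trans (ler_wpM2r _ ye); last by rewrite divr_ge0 ?ltW.
suff -> : y * (sigma ^+ 2 *+ 2 / n%:R) = n%:R by [].
by rewrite /y expr2 -mulrA mulrA -mulrA mulKf ?gt_eqF// mulfK ?gt_eqF.
Qed.

Let half : (\int[mu]_(x in `[0%R, +oo[) (x ^+ 2 * p x)%:E =
  (sigma ^+ 2)%:E * \int[mu]_(x in `[0%R, +oo[) (p x)%:E)%E.
Proof.
have h1 := @ge0_cvgn_integral R mu (fun x => x ^+ 2 * p x)
  (fun x => mulr_ge0 (sqr_ge0 x) (p0 x)) ltac:(by apply: measurable_funM).
have h2 := @ge0_cvgn_integral R mu p p0 (@mp setT).
have i_fin : (\int[mu]_(x in `[0%R, +oo[) (p x)%:E)%E \is a fin_num.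
  apply: integrable_fin_num => //.
  by apply: (@integrableS _ _ _ mu setT) => //; exact: integrable_normal_pdf.
have h3 : ((- sigma ^+ 2 * (n%:R * p n%:R))%:E +
     (sigma ^+ 2)%:E * \int[mu]_(x in `[0%R, n%:R]) (p x)%:E)%E @[n --> \oo] -->
    (0%:E + (sigma ^+ 2)%:E * \int[mu]_(x in `[0%R, +oo[) (p x)%:E)%E.
  apply: cvgeD => //.
  - by apply: cvg_EFin; [exact: nearW|exact: cvg0Z].
  - exact: cvgeZl.
rewrite add0e in h3.
apply: (cvg_unique _ h1) => //; apply: cvg_trans h3; apply: near_eq_cvg.
by near=> n; apply/esym/partial; near: n; exact: nbhs_infty_gt.
Unshelve. all: by end_near.
Qed.

Let second : (\int[mu]_x (x ^+ 2 * p x)%:E)%E = (sigma ^+ 2)%:E.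
Proof.
have e0 : [set x : R | 0 <= x] = `[0%R, +oo[%classic.
  by apply/seteqP; split => x/=; rewrite in_itv/= andbT.
rewrite ge0_symfun_integralT; last 3 first.
- by move=> x; rewrite mulr_ge0 ?sqr_ge0.
- by move=> x; apply: cvgM; [exact: exprn_continuous|exact: cp].
- by move=> x /=; rewrite sqrrN pN.
rewrite e0 half muleCA -e0 -ge0_symfun_integralT//; last first.
  by move=> x /=; rewrite pN.
by rewrite integral_normal_pdf mule1.
Qed.

(** [normal_prob] is the measure of density [p], which is therefore almost everywhere its
    Radon-Nikodym derivative. *)
Let law_density (g : R -> \bar R) : measurable_fun setT g -> (forall x, 0 <= g x)%E ->
  (\int[normal_prob 0 sigma]_x g x = \int[mu]_x (g x * (p x)%:E))%E.
Proof.
move=> mg g0.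
have dom := normal_prob_dominates 0 sigma.
rewrite -(Radon_Nikodym_SigmaFinite.change_of_variables dom g0 measurableT mg).
set fR := Radon_Nikodym_SigmaFinite.f _ _.
have ifR : mu.-integrable setT fR by exact: Radon_Nikodym_SigmaFinite.f_integrable.
apply: ge0_ae_eq_integral => //.
- by apply: emeasurable_funM => //; exact: measurable_int ifR.
- by apply: emeasurable_funM => //; apply/measurable_EFinP; exact: mp.
- by move=> x _; rewrite mule_ge0//; exact: Radon_Nikodym_SigmaFinite.f_ge0.
- by move=> x _; rewrite mule_ge0// lee_fin.
apply: ae_eqe_mul2l; apply: integral_ae_eq => //.
- by apply/measurable_EFinP; exact: mp.
- by move=> E _ mE; rewrite -Radon_Nikodym_SigmaFinite.f_integral.
Qed.

Let reflect (g : R -> \bar R) : measurable_fun setT g -> (forall x, 0 <= g x)%E ->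
  (\int[mu]_x g x = \int[mu]_x g (- x)%R)%E.
Proof.
move=> mg g0.
have mo : measurable_fun setT (-%R : measurableTypeR R -> measurableTypeR R).
  exact: oppr_measurable.
transitivity (\int[pushforward mu (-%R : measurableTypeR R -> measurableTypeR R)]_x g x)%E; last first.
  exact: (@ge0_integral_pushforward _ _ (measurableTypeR R) (measurableTypeR R) R _ mo mu setT g).
by apply: eq_measure_integral => A mA _; exact/esym/lebesgue_measureN.
Qed.

(** The variance comes from integration by parts. The mean vanishes because the density is
    even: the positive and negative parts of [X] have the same integral. *)
Lemma normal_law_moments d (T : measurableType d) (P : probability T R) (X : T -> R) :
  measurable_fun setT X ->
  (forall B : set R, measurable B -> P (X @^-1` B) = normal_prob 0 sigma B) ->
  [/\ sqi P setT X, \int[P]_w X w = 0 & ip P setT X X = sigma ^+ 2].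
Proof.
move=> mX hX.
have tr (g : R -> \bar R) : measurable_fun setT g -> (forall x, 0 <= g x)%E ->
    (\int[P]_w g (X w) = \int[mu]_x (g x * (p x)%:E))%E.
  move=> mg g0; rewrite -law_density//.
  have mX' : measurable_fun setT (X : T -> measurableTypeR R) by [].
  pose X' : {RV P >-> measurableTypeR R} :=
    HB.pack (X : T -> measurableTypeR R) (isMeasurableFun.Build _ _ _ _ _ mX').
  rewrite -[LHS](@ge0_integral_distribution _ _ _ _ _ P X' g)//.
  by apply: eq_measure_integral => A mA _; exact: hX.
have sq : (\int[P]_w (X w ^+ 2)%:E = (sigma ^+ 2)%:E)%E.
  rewrite (tr (fun x => (x ^+ 2)%:E)) -?second//.
    by apply/measurable_EFinP; exact: exprn_measurable.
  by move=> x; rewrite lee_fin sqr_ge0.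
have sX : sqi P setT X by split => //; rewrite sq ltry.
split => //; last by apply: EFin_inj; rewrite ipE.
have iX : P.-integrable setT (EFin \o X).
  exact: (sqi_int measurableT (prob_fin P) sX).
have mmax : measurable_fun setT (fun x : R => (Num.max x 0)%:E).
  by apply/measurable_EFinP; exact: measurable_maxr.
have mmaxN : measurable_fun setT (fun x : R => (Num.max (- x) 0)%:E).
  by apply/measurable_EFinP; apply: measurable_maxr => //; exact: oppr_measurable.
have m0 (y : R) : (0 <= (Num.max y 0)%:E)%E by rewrite lee_fin le_max lexx orbT.
have mpE : measurable_fun setT (fun x : R => (p x)%:E) by apply/measurable_EFinP; exact: mp.
have e : (\int[P]_w (Num.max (X w) 0)%:E = \int[P]_w (Num.max (- X w) 0)%:E)%E.
  rewrite (tr (fun x => (Num.max x 0)%:E))// (tr (fun x => (Num.max (- x) 0)%:E))//.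
  rewrite reflect.
  - by apply: eq_integral => x _; rewrite pN.
  - exact: emeasurable_funM.
  - by move=> x; rewrite mule_ge0// lee_fin.
have fp w : ((EFin \o X)^\+ w = (Num.max (X w) 0)%:E)%E by rewrite funeposE EFin_max.
have fn w : ((EFin \o X)^\- w = (Num.max (- X w) 0)%:E)%E by rewrite funenegE EFin_max.
have ffin := integrable_pos_fin_num measurableT iX.
rewrite /Rintegral integralE.
move: ffin; under eq_integral do rewrite fp.
under [in X in _ -> fine (_ - X)%E = 0]eq_integral do rewrite fn.
by rewrite -e => ?; rewrite subee.
Qed.

End gaussian_moments.

(** * Random variables measurable for a sub-sigma-algebra *)

Section measurable_wrt.
Context d (T : measurableType d) (R : realType).
Implicit Types (G H : set (set T)) (X Y : T -> R).

Lemma measurable_wrtP G X : sigma_algebra setT G ->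
  measurable_wrt G X <-> measurable_fun setT (X : g_sigma_algebraType G -> R).
Proof.
move=> sG; split => h; [move=> _ B mB|move=> B mB].
  by rewrite setTI; rewrite measurable_g_measurableTypeE//; exact: h.
by have := h measurableT B mB; rewrite setTI measurable_g_measurableTypeE.
Qed.

Lemma wrt_cst G (c : R) : sigma_algebra setT G -> measurable_wrt G (cst c : T -> R).
Proof. by move=> sG; apply/measurable_wrtP => //; exact: measurable_cst. Qed.

Lemma wrtD G X Y : sigma_algebra setT G ->
  measurable_wrt G X -> measurable_wrt G Y -> measurable_wrt G (X + Y).
Proof.
move=> sG /measurable_wrtP -/(_ sG) mX /measurable_wrtP -/(_ sG) mY.
by apply/measurable_wrtP => //; exact: measurable_funD.
Qed.

Lemma wrtM G X Y : sigma_algebra setT G ->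
  measurable_wrt G X -> measurable_wrt G Y -> measurable_wrt G (fun w => X w * Y w).
Proof.
move=> sG /measurable_wrtP -/(_ sG) mX /measurable_wrtP -/(_ sG) mY.
by apply/measurable_wrtP => //; exact: measurable_funM.
Qed.

Lemma wrtZ G X (c : R) : sigma_algebra setT G ->
  measurable_wrt G X -> measurable_wrt G (c *: X).
Proof. by move=> sG mX; apply: (@wrtM G (cst c) X) => //; exact: wrt_cst. Qed.

Lemma wrtB G X Y : sigma_algebra setT G ->
  measurable_wrt G X -> measurable_wrt G Y -> measurable_wrt G (X - Y).
Proof. by move=> sG mX mY; rewrite -scaleN1r; apply: wrtD => //; apply: wrtZ. Qed.

Lemma wrt_sum G n (X : nat -> T -> R) : sigma_algebra setT G ->
  (forall i, (i < n)%N -> measurable_wrt G (X i)) ->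
  measurable_wrt G (\sum_(i < n) X i).
Proof.
move=> sG; elim: n => [|n ih] h; first by rewrite big_ord0; exact: (wrt_cst 0).
rewrite big_ord_recr /=; apply: wrtD => //; last exact: h.
by apply: ih => i ni; apply: h; apply: leqW.
Qed.

Lemma wrt_sub G H X : G `<=` H -> measurable_wrt G X -> measurable_wrt H X.
Proof. by move=> GH mX B mB; apply/GH/mX. Qed.

Lemma wrt_fun G X : G `<=` measurable -> measurable_wrt G X -> measurable_fun setT X.
Proof. by move=> Gm mX _ B mB; rewrite setTI; apply/Gm/mX. Qed.

Lemma independent_rv (P : probability T R) G H X Y : independent P G H ->
  measurable_wrt G X -> measurable_wrt H Y -> indep_rv P X Y.
Proof. by move=> GH mX mY A B mA mB; apply: GH; [exact: mX|exact: mY]. Qed.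

End measurable_wrt.

(** * Increments of a Wiener process *)

Section wiener.
Context (R : realType) d (Omega : measurableType d) (P : probability Omega R).
Variables (F : R -> set (set Omega)) (m : nat) (W : 'I_m -> R -> Omega -> R).
Hypotheses (hF : filtration F) (hW : wiener_process P F W).
Implicit Types (s u : R) (X : Omega -> R).

Lemma F_wrt s u X : 0 <= s -> s <= u -> measurable_wrt (F s) X -> measurable_wrt (F u) X.
Proof. by move=> s0 su; apply: wrt_sub; exact: (filtration_nondecreasing hF). Qed.

Lemma F_sigma s : 0 <= s -> sigma_algebra setT (F s).
Proof. exact: (filtration_sigma_algebra hF). Qed.

Lemma F_fun s X : 0 <= s -> measurable_wrt (F s) X -> measurable_fun setT X.
Proof. by move=> s0; apply: wrt_fun; exact: (filtration_measurable hF). Qed.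

Lemma W_wrt i s u : 0 <= s -> s <= u -> measurable_wrt (F u) (W i s).
Proof. by move=> s0 su; apply: (F_wrt s0 su); exact: (wiener_adapted hW). Qed.

Lemma incr_wrt i s u : 0 <= s -> s <= u -> measurable_wrt (F u) (W i u - W i s).
Proof.
move=> s0 su; have u0 := le_trans s0 su.
by apply: wrtB; [exact: F_sigma|exact: W_wrt|exact: W_wrt].
Qed.

Lemma incr_fun i s u : 0 <= s -> s <= u -> measurable_fun setT (W i u - W i s).
Proof. by move=> s0 su; apply: (F_fun (le_trans s0 su)); exact: incr_wrt. Qed.

Lemma incr_moments i s u : 0 <= s -> s <= u ->
  [/\ sqi P setT (W i u - W i s), \int[P]_w (W i u w - W i s w) = 0 &
      ip P setT (W i u - W i s) (W i u - W i s) = u - s].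
Proof.
move=> s0; rewrite le_eqVlt => /predU1P[->|su].
  rewrite !subrr ip0l; split => //; first exact: sqi0.
  by under eq_Rintegral do rewrite subrr; rewrite /Rintegral integral0.
have us : 0 < Num.sqrt (u - s) by rewrite sqrtr_gt0 subr_gt0.
have [h1 h2 h3] := normal_law_moments us (incr_fun i s0 (ltW su))
  (@wiener_normal_increments _ _ _ _ _ _ _ hW i s u s0 su).
by rewrite h3 sqr_sqrtr ?subr_ge0 ?ltW.
Qed.

Lemma incr_indep i s u X : 0 <= s -> s <= u -> measurable_wrt (F s) X ->
  indep_rv P X (W i u - W i s).
Proof.
move=> s0; rewrite le_eqVlt => /predU1P[<-|su] mX.
  move=> A B mA mB; rewrite subrr.
  have [B0|B0] := pselect (B 0).
    have -> : (0 : Omega -> R) @^-1` B = setT by apply/seteqP; split.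
    by rewrite setIT probability_setT mule1.
  have -> : (0 : Omega -> R) @^-1` B = set0 by apply/seteqP; split.
  by rewrite setI0 measure0 mule0.
apply: (independent_rv (wiener_independent_increments hW s0 su)) => //.
move=> B mB; apply: sub_sigma_algebra; rewrite (bigD1 i)//=; left; exists B => //.
by rewrite setTI.
Qed.

Lemma incr_mean0 i s u X : 0 <= s -> s <= u -> measurable_wrt (F s) X ->
  P.-integrable setT (EFin \o X) ->
  \int[P]_w (X w * (W i u w - W i s w)) = 0.
Proof.
move=> s0 su mX iX; have [sW W0 _] := incr_moments i s0 su.
have := indep_expectationM (F_fun s0 mX) (incr_fun i s0 su) (incr_indep i s0 su mX) iX
  (sqi_int measurableT (prob_fin P) sW).
by rewrite W0 mulr0.
Qed.

Lemma indep_rv_sqr (X Y : Omega -> R) : indep_rv P X Y -> indep_rv P X (fun w => Y w ^+ 2).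
Proof.
move=> h A B mA mB.
have mB' : measurable ((fun y : R => y ^+ 2) @^-1` B).
  by rewrite -[_ @^-1` _]setTI; apply: exprn_measurable.
exact: (h A _ mA mB').
Qed.

Lemma incr_var i s u X : 0 <= s -> s <= u -> measurable_wrt (F s) X ->
  P.-integrable setT (EFin \o X) ->
  P.-integrable setT (EFin \o (fun w => X w * (W i u w - W i s w) ^+ 2)) /\
  \int[P]_w (X w * (W i u w - W i s w) ^+ 2) = \int[P]_w X w * (u - s).
Proof.
move=> s0 su mX iX; have [sW _ <-] := incr_moments i s0 su.
have ind := indep_rv_sqr (incr_indep i s0 su mX).
have m2 : measurable_fun setT (fun w => (W i u - W i s) w ^+ 2).
  by apply: measurable_funX; exact: incr_fun.
have i2 := sqi_integrable sW.
split; first exact: (indep_integrableM (F_fun s0 mX) m2 ind iX i2).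
exact: (indep_expectationM (F_fun s0 mX) m2 ind iX i2).
Qed.

Definition ito_inc (B : R -> Omega -> R) (a : Omega -> R) (u u' : R) : Omega -> R :=
  fun w => a w * (B u' w - B u w).

(** The length of the common part of the intervals from [u] to [u'] and from [v] to [v']. *)
Definition overlap (u u' v v' : R) : R := Num.max 0 (Num.min u' v' - Num.max u v).

Definition adm_F u (a : Omega -> R) : Prop := measurable_wrt (F u) a /\ sqi P setT a.

Let mT := @measurableT _ Omega.

Lemma sqi_ito_inc i a u u' : 0 <= u -> u <= u' -> adm_F u a ->
  sqi P setT (ito_inc (W i) a u u').
Proof.
move=> u0 uu' [wa sa]; apply: integrable_sqi.
  by apply: measurable_funM; [case: sa|exact: (incr_fun i u0 uu')].
have wa2 : measurable_wrt (F u) (fun w => a w * a w) by apply: wrtM => //; exact: F_sigma.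
have [h _] := incr_var i u0 uu' wa2 (sqi_mul mT sa sa).
by apply: eq_integrable h => // w _ /=; rewrite /ito_inc exprMn expr2.
Qed.

Lemma ito_inc_wrt i a u u' : 0 <= u -> u <= u' -> measurable_wrt (F u) a ->
  measurable_wrt (F u') (ito_inc (W i) a u u').
Proof.
move=> u0 uu' wa; apply: wrtM; first exact: F_sigma (le_trans u0 uu').
  exact: F_wrt wa.
exact: incr_wrt.
Qed.

Lemma ito_inc_orth i a b u u' v v' : 0 <= u -> u <= u' -> u' <= v -> v <= v' ->
  adm_F u a -> adm_F v b -> ip P setT (ito_inc (W i) a u u') (ito_inc (W i) b v v') = 0.
Proof.
move=> u0 uu' u'v vv' [wa sa] [wb sb].
have u'0 := le_trans u0 uu'; have v0 := le_trans u'0 u'v.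
have si := sqi_ito_inc i u0 uu' (conj wa sa).
have wi : measurable_wrt (F v) (fun w => ito_inc (W i) a u u' w * b w).
  by apply: wrtM => //; [exact: F_sigma|apply: F_wrt (ito_inc_wrt i u0 uu' wa)].
have := incr_mean0 i v0 vv' wi (sqi_mul mT si sb).
by under eq_Rintegral do rewrite -mulrA.
Qed.

Lemma ito_incD B a u v w : ito_inc B a u w = ito_inc B a u v + ito_inc B a v w.
Proof.
apply/funext => x; rewrite addrfctE /ito_inc -mulrDr; congr (_ * _).
by rewrite [RHS]addrC subrKA.
Qed.

Lemma overlapC u u' v v' : overlap u u' v v' = overlap v v' u u'.
Proof. by rewrite /overlap minC (maxC u). Qed.

Let ito_inc_pair_le i a b u u' v v' : 0 <= u -> u <= u' -> u <= v -> v <= v' ->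
  adm_F u a -> adm_F v b ->
  ip P setT (ito_inc (W i) a u u') (ito_inc (W i) b v v') = ip P setT a b * overlap u u' v v'.
Proof.
move=> u0 uu' uv vv' aa ab; have v0 := le_trans u0 uv.
rewrite /overlap (max_r uv).
have [u'v|vu'] := leP u' v.
  rewrite ito_inc_orth// max_l ?mulr0// subr_le0.
  by rewrite ge_min u'v.
set m0 := Num.min u' v'.
have vm : v <= m0 by rewrite le_min vv' ltW.
have mu' : m0 <= u' by rewrite ge_min lexx.
have mv' : m0 <= v' by rewrite ge_min lexx orbT.
have m0' := le_trans v0 vm; have u'0 := le_trans u0 uu'.
rewrite max_r ?subr_ge0//.
have adm x y c : 0 <= x -> x <= y -> adm_F x c -> adm_F y c.
  by move=> x0 xy [wc sc]; split => //; apply: F_wrt wc.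
have aav := adm _ _ _ u0 uv aa; have aam := adm _ _ _ v0 vm aav.
have abm := adm _ _ _ v0 vm ab.
have s1 := sqi_ito_inc i u0 uv aa.
have s2 := sqi_ito_inc i v0 vm aav.
have s3 := sqi_ito_inc i m0' mu' aam.
have s4 := sqi_ito_inc i v0 vm ab.
have s5 := sqi_ito_inc i m0' mv' abm.
rewrite (ito_incD _ a u v u') (ito_incD _ a v m0 u') (ito_incD _ b v m0 v').
have sD := sqiD mT s2 s3.
rewrite (ipDl mT s1 sD (sqiD mT s4 s5)) (ipDl mT s2 s3 (sqiD mT s4 s5)).
rewrite (ipDr mT s4 s5 s1) (ipDr mT s4 s5 s2) (ipDr mT s4 s5 s3).
rewrite (ito_inc_orth i u0 uv (lexx _) vm aa ab) (ito_inc_orth i u0 uv vm mv' aa abm).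
rewrite (ito_inc_orth i v0 vm (lexx _) mv' aav abm).
rewrite (ipC _ _ (ito_inc (W i) a m0 u') (ito_inc (W i) b v m0)).
rewrite (ito_inc_orth i v0 vm (lexx _) mu' ab aam).
have -> : ip P setT (ito_inc (W i) a m0 u') (ito_inc (W i) b m0 v') = 0.
  have inc0 c x : ito_inc (W i) c x x = 0.
    by apply/funext => w; rewrite /ito_inc subrr mulr0.
  have [h|h] := leP u' v'.
    by rewrite (_ : m0 = u') ?inc0 ?ip0l//; rewrite /m0 min_l.
  by rewrite (_ : m0 = v') ?inc0 1?ipC ?ip0l//; rewrite /m0 min_r// ltW.
rewrite !addr0 !add0r.
have wab : measurable_wrt (F v) (fun w => a w * b w).
  by apply: wrtM; [exact: F_sigma|exact: aav.1|exact: ab.1].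
have [_ <-] := incr_var i v0 vm wab (sqi_mul mT aa.2 ab.2).
by apply: eq_Rintegral => w _; rewrite /ito_inc; ring.
Qed.

(** Cut the two intervals at their common end points. The pieces that do not overlap are
    orthogonal, because an increment is centered and independent of the past; on the common
    piece the squared increment is independent of both weights. *)
Lemma ito_inc_pair i a b u u' v v' : 0 <= u -> u <= u' -> 0 <= v -> v <= v' ->
  adm_F u a -> adm_F v b ->
  ip P setT (ito_inc (W i) a u u') (ito_inc (W i) b v v') = ip P setT a b * overlap u u' v v'.
Proof.
move=> u0 uu' v0 vv' aa ab; have [uv|/ltW vu] := leP u v.
  exact: ito_inc_pair_le.
by rewrite ipC ito_inc_pair_le// ipC overlapC.
Qed.

Lemma sigma_process_algebra i : sigma_algebra setT (sigma_process (W i)).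
Proof. exact: smallest_sigma_algebra. Qed.

Lemma sigma_process_measurable i : sigma_process (W i) `<=` measurable.
Proof.
apply: smallest_sub; first exact: sigma_algebra_measurable.
move=> A [s /= s0 [B mB <-]].
by apply: (F_fun s0 (W_wrt i s0 (lexx s))).
Qed.

Lemma W_sigma_process i s : 0 <= s -> measurable_wrt (sigma_process (W i)) (W i s).
Proof.
move=> s0 B mB; apply: sub_sigma_algebra; exists s => //=; exists B => //.
by rewrite setTI.
Qed.

Lemma incr_sigma_process i s u : 0 <= s -> 0 <= u ->
  measurable_wrt (sigma_process (W i)) (W i u - W i s).
Proof.
move=> s0 u0; apply: wrtB; [exact: sigma_process_algebra|exact: W_sigma_process..].
Qed.

Lemma sigma_process_indep i j : i != j ->
  independent P (sigma_process (W i)) (sigma_process (W j)).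
Proof.
move=> ij A B hA hB.
have := wiener_independent_components hW (J := [set i; j]%SET)
  (A := fun k => if k == i then A else B).
rewrite !big_setU1 ?inE//= !big_set1 eqxx eq_sym (negbTE ij); apply.
by move=> k; rewrite !inE => /orP[|] /eqP ->; rewrite ?eqxx// eq_sym (negbTE ij).
Qed.

Section two_components.
Variables (i1 i2 : 'I_m).
Hypothesis i12 : i1 != i2.

(** Weights that may anticipate the whole path of the first component, with the signature of
    [adm_F]. *)
Definition adm_S (u : R) (a : Omega -> R) : Prop :=
  measurable_wrt (sigma_process (W i1)) a /\ sqi P setT a.

Let S1 := sigma_process_algebra i1.
Let S2 := sigma_process_algebra i2.
Let fS i X : measurable_wrt (sigma_process (W i)) X -> measurable_fun setT X.
Proof. by apply: wrt_fun; exact: sigma_process_measurable. Qed.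

Lemma sqi_ito_inc_S a u u' : 0 <= u -> u <= u' -> adm_S u a ->
  sqi P setT (ito_inc (W i2) a u u').
Proof.
move=> u0 uu' [wa sa].
have [si _ _] := incr_moments i2 u0 uu'.
have wi := incr_sigma_process (i := i2) u0 (le_trans u0 uu').
apply: integrable_sqi; first by apply: measurable_funM; [exact: fS wa|exact: fS wi].
have wa2 := wrtM S1 wa wa; have wi2 := wrtM S2 wi wi.
have := indep_integrableM (fS wa2) (fS wi2)
  (independent_rv (sigma_process_indep i12) wa2 wi2) (sqi_mul mT sa sa) (sqi_mul mT si si).
by apply: eq_integrable => // w _ /=; rewrite /ito_inc exprMn !expr2.
Qed.

Lemma adm_F_cst c u : 0 <= u -> adm_F u (cst c).
Proof.
move=> u0; split; first by apply: wrt_cst; exact: F_sigma.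
exact: (sqi_cst c mT (prob_fin P)).
Qed.

(** The weights depend on the first component and the increments on the second one, so the
    expectation of their product factors. This takes the place of the independence of an
    increment from the past. *)
Lemma ito_inc_pair_S a b u u' v v' : 0 <= u -> u <= u' -> 0 <= v -> v <= v' ->
  adm_S u a -> adm_S v b ->
  ip P setT (ito_inc (W i2) a u u') (ito_inc (W i2) b v v') = ip P setT a b * overlap u u' v v'.
Proof.
move=> u0 uu' v0 vv' [wa sa] [wb sb].
have [si _ _] := incr_moments i2 u0 uu'.
have [sj _ _] := incr_moments i2 v0 vv'.
have wi := incr_sigma_process (i := i2) u0 (le_trans u0 uu').
have wj := incr_sigma_process (i := i2) v0 (le_trans v0 vv').
have wab := wrtM S1 wa wb; have wij := wrtM S2 wi wj.
transitivity (ip P setT a b * ip P setT (W i2 u' - W i2 u) (W i2 v' - W i2 v)).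
  rewrite -(indep_expectationM (fS wab) (fS wij)
    (independent_rv (sigma_process_indep i12) wab wij) (sqi_mul mT sa sb) (sqi_mul mT si sj)).
  by apply: eq_Rintegral => w _; rewrite /ito_inc !addrfctE !opprfctE; ring.
congr (_ * _).
have := ito_inc_pair i2 u0 uu' v0 vv' (adm_F_cst 1 u0) (adm_F_cst 1 v0).
have e x y : ito_inc (W i2) (cst 1) x y = W i2 y - W i2 x.
  by apply/funext => w; rewrite /ito_inc mul1r.
rewrite !e => ->.
rewrite [X in X * _](_ : _ = 1) ?mul1r//.
by rewrite /ip; under eq_Rintegral do rewrite mul1r; exact: Rintegral_prob_cst.
Qed.

End two_components.
End wiener.

(** * Ito's isometry for step processes *)

Lemma itv_co_fin (R : realType) (a b : R) : (@lebesgue_measure R `[a, b[%classic < +oo)%E.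
Proof. by rewrite lebesgue_measure_itv/=; case: ifP => _; rewrite -?EFinD ltry. Qed.

Lemma lebesgue_itv_co (R : realType) (a b : R) : fine (@lebesgue_measure R `[a, b[%classic) = Num.max 0 (b - a).
Proof.
rewrite lebesgue_measure_itv/= lte_fin; case: ltP => h.
  by rewrite -EFinD /= max_r// subr_ge0 ltW.
by rewrite max_l//= subr_le0.
Qed.

Section isometry.
Context (R : realType) d (Omega : measurableType d) (P : probability Omega R).
Local Notation mu := (@lebesgue_measure R).
Variables (B : R -> Omega -> R) (adm : R -> (Omega -> R) -> Prop) (t T : R).
Hypotheses (t0 : 0 <= t) (adm_sqi : forall u a, adm u a -> sqi P setT a).
Hypothesis inc_sqi : forall a u u', 0 <= u -> u <= u' -> adm u a ->
  sqi P setT (ito_inc B a u u').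
Hypothesis inc_pair : forall a b u u' v v', 0 <= u -> u <= u' -> 0 <= v -> v <= v' ->
  adm u a -> adm v b ->
  ip P setT (ito_inc B a u u') (ito_inc B b v v') = ip P setT a b * overlap u u' v v'.
Implicit Types (H : @step_process R _ Omega).
Local Notation D := (`[t, T[%classic : set R).
Local Notation ipP := (ip P setT).

(** The isometry is used for two classes of values on an interval starting at [u], [adm_F] and
    [adm_S]; the parameter [adm] stands for either. The intervals may be empty. *)
Definition adm_step H : Prop := forall k, (k < step_size H)%N ->
  [/\ t <= step_time H k, step_time H k <= step_time H k.+1, step_time H k.+1 <= T &
      adm (step_time H k) (step_val H k)].

Let mT := @measurableT _ Omega.

Let chi H k : R -> R := \1_(`[step_time H k, step_time H k.+1[).

Lemma step_funE H s : step_fun H s = \sum_(k < step_size H) chi H k s *: step_val H k.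
Proof.
by apply/funext => w; rewrite fct_sumE; apply: eq_bigr => k _; rewrite mulrC.
Qed.

Lemma step_itoE H : step_ito B H =
  \sum_(k < step_size H) ito_inc B (step_val H k) (step_time H k) (step_time H k.+1).
Proof. by apply/funext => w; rewrite fct_sumE; apply: eq_bigr. Qed.

Lemma sqi_step_fun H s : adm_step H -> sqi P setT (step_fun H s).
Proof.
move=> aH; rewrite step_funE; apply: sqi_sum => // k _; apply: sqiZ => //.
by have [_ _ _ /adm_sqi] := aH k (ltn_ord k).
Qed.

Lemma sqi_step_ito H : adm_step H -> sqi P setT (step_ito B H).
Proof.
move=> aH; rewrite step_itoE; apply: sqi_sum => // k _.
by have [tk kk _ ak] := aH k (ltn_ord k); apply: inc_sqi => //; exact: le_trans tk.
Qed.

Lemma sqi_indic_itv (u u' : R) : sqi mu D (\1_(`[u, u'[) : R -> R).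
Proof.
split; first exact: measurable_indic.
apply: (@le_lt_trans _ _ (\int[mu]_(x in D) (cst 1%E x))%E).
  apply: ge0_le_integral_nomeas => x _; first by rewrite lee_fin sqr_ge0.
  by rewrite lee_fin /= indicE; case: (_ \in _); rewrite ?expr1n ?expr0n.
by rewrite integral_cst//= mul1e itv_co_fin.
Qed.

Lemma ip_indic_itv u u' v v' : t <= u -> u <= u' -> u' <= T -> t <= v -> v <= v' -> v' <= T ->
  ip mu D \1_(`[u, u'[) \1_(`[v, v'[) = overlap u u' v v'.
Proof.
move=> tu uu' uT tv vv' vT.
have e : D `&` (`[u, u'[ `&` `[v, v'[) = `[Num.max u v, Num.min u' v'[%classic.
  apply/seteqP; split => x /=; rewrite !in_itv/= ge_max lt_min.
    by move=> [_ [/andP[-> ->] /andP[-> ->]]].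
  move=> /andP[/andP[ux vx] /andP[xu xv]]; rewrite ux vx xu xv.
  by rewrite (le_trans tu ux) (lt_le_trans xu uT).
rewrite /ip; under eq_Rintegral => x _.
  rewrite (_ : _ * _ = \1_(`[u, u'[ `&` `[v, v'[) x); last by rewrite indicI.
  over.
rewrite /Rintegral integral_indic//; last exact: measurableI.
by rewrite setIC e lebesgue_itv_co.
Qed.

(** Ito's isometry in bilinear form, for step processes on unrelated partitions:
    both sides are the sums of [ip P setT a b * overlap u u' v v'] over the pairs of steps. *)
Lemma ito_isometry H H' : adm_step H -> adm_step H' ->
  mu.-integrable D (EFin \o (fun s => ipP (step_fun H s) (step_fun H' s))) /\
  ipP (step_ito B H) (step_ito B H') = \int[mu]_(s in D) ipP (step_fun H s) (step_fun H' s).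
Proof.
move=> aH aH'.
pose c k l := ipP (step_val H k) (step_val H' l).
have sv k : (k < step_size H)%N -> sqi P setT (step_val H k).
  by move=> /aH[_ _ _ /adm_sqi].
have sv' k : (k < step_size H')%N -> sqi P setT (step_val H' k).
  by move=> /aH'[_ _ _ /adm_sqi].
have e s : ipP (step_fun H s) (step_fun H' s) =
    \sum_(k < step_size H) \sum_(l < step_size H') c k l * (chi H k s * chi H' l s).
  rewrite (step_funE H) (ip_suml mT (F := fun k => chi H k s *: step_val H k)); last 2 first.
  - by move=> k kn; apply: sqiZ => //; exact: sv.
  - exact: sqi_step_fun.
  apply: eq_bigr => k _.
  rewrite step_funE (ip_sumr mT (F := fun k => chi H' k s *: step_val H' k)); last 2 first.
  - by move=> l ln; apply: sqiZ => //; exact: sv'.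
  - by apply: sqiZ => //; exact: sv.
  apply: eq_bigr => l _.
  rewrite ipZl//; [|exact: sv|by apply: sqiZ => //; exact: sv'].
  by rewrite ipZr//; [rewrite /c; ring|exact: sv'|exact: sv].
have mD : measurable (D : set (measurableTypeR R)) by [].
have ic k l : mu.-integrable D (EFin \o (fun s => c k l * (chi H k s * chi H' l s))).
  have i0 : mu.-integrable D (EFin \o (fun s => chi H k s * chi H' l s)).
    by apply: sqi_mul => //; exact: sqi_indic_itv.
  by have := integrableZl mD (c k l) i0; apply: eq_integrable => // s _ /=.
have icl k := Rintegral_sum mD (fun l (_ : (l < step_size H')%N) => ic k l).
have [ick ek] := Rintegral_sum mD (fun k (_ : (k < step_size H)%N) => (icl k).1).
split; first by apply: eq_integrable ick => // s _ /=; rewrite e.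
under eq_Rintegral do rewrite e.
rewrite ek !step_itoE.
rewrite (ip_suml mT (F := fun k => ito_inc B (step_val H k) (step_time H k) (step_time H k.+1))); last 2 first.
- move=> k kn; have [tk kk _ ak] := aH k kn; apply: inc_sqi => //; exact: le_trans tk.
- by rewrite -step_itoE; exact: sqi_step_ito.
apply: eq_bigr => k _; rewrite (icl k).2.
have [tk kk kT ak] := aH k (ltn_ord k); have k0 := le_trans t0 tk.
rewrite (ip_sumr mT (F := fun k => ito_inc B (step_val H' k) (step_time H' k) (step_time H' k.+1))); last 2 first.
- move=> l ln; have [tl ll _ al] := aH' l ln; apply: inc_sqi => //; exact: le_trans tl.
- exact: inc_sqi.
apply: eq_bigr => l _.
have [tl ll lT al] := aH' l (ltn_ord l); have l0 := le_trans t0 tl.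
rewrite inc_pair// -ip_indic_itv// -RintegralZl//.
by apply: sqi_mul => //; exact: sqi_indic_itv.
Qed.

Let isometric (X : Omega -> R) (f : R -> Omega -> R) (Y : Omega -> R) (g : R -> Omega -> R) :=
  mu.-integrable D (EFin \o (fun s => ipP (f s) (g s))) /\
  ipP X Y = \int[mu]_(s in D) ipP (f s) (g s).

Let isometricC X f Y g : isometric X f Y g -> isometric Y g X f.
Proof.
move=> [i e]; split; last by rewrite ipC e; apply: eq_Rintegral => s _; rewrite ipC.
by apply: eq_integrable i => // s _ /=; rewrite ipC.
Qed.

Let isometricB X f X' f' Y g : sqi P setT X -> sqi P setT X' -> sqi P setT Y ->
  (forall s, sqi P setT (f s)) -> (forall s, sqi P setT (f' s)) ->
  (forall s, sqi P setT (g s)) -> isometric X f Y g -> isometric X' f' Y g ->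
  isometric (X - X') (fun s => f s - f' s) Y g.
Proof.
move=> sX sX' sY sf sf' sg [i e] [i' e'].
have mD : measurable (D : set (measurableTypeR R)) by [].
split.
  have := integrableB mD i i'; apply: eq_integrable => // s _ /=.
  by rewrite ipBl.
rewrite (ipBl mT sX sX' sY) e e' -(RintegralB mD i i').
by apply: eq_Rintegral => s _; rewrite ipBl.
Qed.

Let isometricD X f X' f' Y g : sqi P setT X -> sqi P setT X' -> sqi P setT Y ->
  (forall s, sqi P setT (f s)) -> (forall s, sqi P setT (f' s)) ->
  (forall s, sqi P setT (g s)) -> isometric X f Y g -> isometric X' f' Y g ->
  isometric (X + X') (fun s => f s + f' s) Y g.
Proof.
move=> sX sX' sY sf sf' sg [i e] [i' e'].
have mD : measurable (D : set (measurableTypeR R)) by [].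
split.
  have := integrableD mD i i'; apply: eq_integrable => // s _ /=.
  by rewrite ipDl.
rewrite (ipDl mT sX sX' sY) e e' -(RintegralD mD i i').
by apply: eq_Rintegral => s _; rewrite ipDl.
Qed.

(** A linear combination of step processes on different partitions is a step process on a common
    refinement; bilinearity of the isometry takes the place of the refinement. *)
Lemma ito_isometry_sum n (Hs : nat -> step_process) H' :
  (forall j, (j < n)%N -> adm_step (Hs j)) -> adm_step H' ->
  let X := \sum_(j < n) step_ito B (Hs j) - step_ito B H' in
  let f s := \sum_(j < n) step_fun (Hs j) s - step_fun H' s in
  mu.-integrable D (EFin \o (fun s => ipP (f s) (f s))) /\
  ipP X X = \int[mu]_(s in D) ipP (f s) (f s).
Proof.
move=> + aH'.
pose I k := \sum_(j < k) step_ito B (Hs j).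
pose G k s := \sum_(j < k) step_fun (Hs j) s.
move=> aH.
have sI k : (k <= n)%N -> sqi P setT (I k).
  move=> kn; apply: sqi_sum => // j _; apply: sqi_step_ito; apply: aH.
  exact: leq_trans kn.
have sG k s : (k <= n)%N -> sqi P setT (G k s).
  move=> kn; apply: sqi_sum => // j _; apply: sqi_step_fun; apply: aH.
  exact: leq_trans kn.
have base H k : adm_step H -> (k <= n)%N -> isometric (I k) (G k) (step_ito B H) (step_fun H).
  move=> aHH; elim: k => [|k ih] kn.
    split; last first.
      rewrite /I big_ord0 ip0l; under eq_Rintegral do rewrite /G big_ord0 ip0l.
      by rewrite Rintegral_cst// mul0r.
    rewrite (_ : EFin \o _ = cst 0%E); first exact: integrable0.
    by apply/funext => s /=; rewrite /G big_ord0 ip0l.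
  have -> : I k.+1 = I k + step_ito B (Hs k) by rewrite /I big_ord_recr.
  have -> : G k.+1 = (fun s => G k s + step_fun (Hs k) s).
    by apply/funext => s; rewrite /G big_ord_recr.
  have aHk := aH k kn.
  apply: isometricD; [exact/sI/ltnW|exact: sqi_step_ito|exact: sqi_step_ito|
    by move=> s; exact/sG/ltnW|by move=> s; exact: sqi_step_fun|
    by move=> s; exact: sqi_step_fun|exact/ih/ltnW|exact: ito_isometry].
have b2 k : (k <= n)%N -> isometric (I n) (G n) (I k) (G k).
  elim: k => [|k ih] kn.
    split; last first.
      rewrite {2}/I big_ord0 ipC ip0l.
      under eq_Rintegral do rewrite {2}/G big_ord0 ipC ip0l.
      by rewrite Rintegral_cst// mul0r.
    rewrite (_ : EFin \o _ = cst 0%E); first exact: integrable0.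
    by apply/funext => s /=; rewrite {2}/G big_ord0 ipC ip0l.
  have -> : I k.+1 = I k + step_ito B (Hs k) by rewrite /I big_ord_recr.
  have -> : G k.+1 = (fun s => G k s + step_fun (Hs k) s).
    by apply/funext => s; rewrite /G big_ord_recr.
  have aHk := aH k kn.
  apply: isometricC; apply: isometricD; [exact/sI/ltnW|exact: sqi_step_ito|exact: sI|
    by move=> s; exact/sG/ltnW|by move=> s; exact: sqi_step_fun|
    by move=> s; exact: sG|exact/isometricC/ih/ltnW|exact/isometricC/base].
have sB := sqiB mT (sI n (leqnn n)) (sqi_step_ito aH').
have sGB s := sqiB mT (sG n s (leqnn n)) (sqi_step_fun s aH').
have sGn s := sG n s (leqnn n); have sH' s := sqi_step_fun s aH'.
apply: isometricB => //; [exact: sI|exact: sqi_step_ito| |]; apply: isometricC.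
  by apply: isometricB => //; [exact: sI|exact: sqi_step_ito|exact: sI|exact: b2|
    exact/isometricC/base].
by apply: isometricB => //; [exact: sI|exact: sqi_step_ito|exact: sqi_step_ito|exact: base|
  exact: ito_isometry].
Qed.

Lemma ito_isometry_sub H H' : adm_step H -> adm_step H' ->
  mu.-integrable D (EFin \o (fun s =>
    ipP (step_fun H s - step_fun H' s) (step_fun H s - step_fun H' s))) /\
  ipP (step_ito B H - step_ito B H') (step_ito B H - step_ito B H') =
  \int[mu]_(s in D) ipP (step_fun H s - step_fun H' s) (step_fun H s - step_fun H' s).
Proof.
move=> aH aH'.
have := @ito_isometry_sum 1 (fun=> H) H' (fun _ _ => aH) aH'.
rewrite /= big_ord1 => -[h ->]; split.
  by apply: eq_integrable h => // s _ /=; rewrite big_ord1.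
by apply: eq_Rintegral => s _; rewrite big_ord1.
Qed.

End isometry.

(** * Ito integrals of nonrandom functions *)

Section wiener_steps.
Context (R : realType) d (Omega : measurableType d) (P : probability Omega R).
Variables (F : R -> set (set Omega)) (m : nat) (W : 'I_m -> R -> Omega -> R).
Hypotheses (hF : filtration F) (hW : wiener_process P F W).
Local Notation mu := (@lebesgue_measure R).
Local Notation ipP := (ip P setT).
Implicit Types (H : @step_process R _ Omega) (t T : R).

Let mT := @measurableT _ Omega.

Definition is_cst (u : R) (a : Omega -> R) : Prop := exists c, a = cst c.

Lemma adm_step_sub (adm adm' : R -> (Omega -> R) -> Prop) t T H : 0 <= t ->
  (forall u a, 0 <= u -> adm u a -> adm' u a) -> adm_step adm t T H -> adm_step adm' t T H.
Proof.
move=> t0 h aH k kn; have [h1 h2 h3 h4] := aH k kn; split => //.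
by apply: h h4; exact: le_trans h1.
Qed.

Lemma is_cst_F u a : 0 <= u -> is_cst u a -> adm_F P F u a.
Proof. by move=> u0 [c ->]; exact: (adm_F_cst P hF). Qed.

Lemma isometryF_sub i t T H H' : 0 <= t ->
  adm_step (adm_F P F) t T H -> adm_step (adm_F P F) t T H' ->
  mu.-integrable `[t, T[ (EFin \o (fun s =>
    ipP (step_fun H s - step_fun H' s) (step_fun H s - step_fun H' s))) /\
  ipP (step_ito (W i) H - step_ito (W i) H') (step_ito (W i) H - step_ito (W i) H') =
  \int[mu]_(s in `[t, T[) ipP (step_fun H s - step_fun H' s) (step_fun H s - step_fun H' s).
Proof.
move=> t0; apply: ito_isometry_sub => //.
- by move=> u a [].
- by move=> a u u'; exact: (sqi_ito_inc hF hW).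
- by move=> a b u u' v v'; exact: (ito_inc_pair hF hW).
Qed.

Lemma isometryF i t T H H' : 0 <= t ->
  adm_step (adm_F P F) t T H -> adm_step (adm_F P F) t T H' ->
  ipP (step_ito (W i) H) (step_ito (W i) H') =
  \int[mu]_(s in `[t, T[) ipP (step_fun H s) (step_fun H' s).
Proof.
move=> t0 aH aH'; have sqiF u (a : Omega -> R) : adm_F P F u a -> sqi P setT a by case.
have incF a u u' := @sqi_ito_inc _ _ _ _ _ _ _ hF hW i a u u'.
have pairF a b u u' v v' := @ito_inc_pair _ _ _ _ _ _ _ hF hW i a b u u' v v'.
exact: (ito_isometry t0 sqiF incF pairF aH aH').2.
Qed.

Lemma sqi_step_itoF i t T H : 0 <= t -> adm_step (adm_F P F) t T H ->
  sqi P setT (step_ito (W i) H).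
Proof.
by move=> t0; apply: sqi_step_ito => // a u u'; exact: (sqi_ito_inc hF hW).
Qed.

Lemma sqi_step_funF t T H s : adm_step (adm_F P F) t T H -> sqi P setT (step_fun H s).
Proof. by apply: sqi_step_fun => u a []. Qed.

Lemma nonanticipating_adm t T H : nonanticipating_step P F t T H ->
  adm_step (adm_F P F) t T H.
Proof.
move=> [h0 hn hlt hv] k kn.
have mono a b : (a <= b)%N -> (b <= step_size H)%N -> step_time H a <= step_time H b.
  elim: b => [|b ih]; first by rewrite leqn0 => /eqP ->.
  rewrite leq_eqVlt => /predU1P[->//|]; rewrite ltnS => ab bn.
  by apply: le_trans (ih ab (ltnW bn)) (ltW (hlt _ bn)).
split.
- by rewrite -h0; apply: mono => //; exact: ltnW.
- exact/ltW/hlt.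
- by rewrite -hn; exact: mono.
- by have [h1 /sqi_Lfun h2] := hv k kn.
Qed.

Definition mean_step H : @step_process R _ Omega :=
  StepProcess (step_size H) (step_time H) (fun k => cst (ipP (step_val H k) (cst 1))).

(** An Ito integral of a nonrandom function is a limit of integrals of nonrandom steps: replace
    the values of the approximating steps by their expectations. By [mean_best] at each time,
    the averaged steps are at least as close to the integrand as the original ones, and their
    distance to the original ones is at most the distance of these to the integrand. *)
Lemma ito_nonrandom i t T f X : 0 <= t -> sqi mu `[t, T[ f ->
  is_ito P F (W i) t T (fun s _ => f s) X ->
  sqi P setT X /\ exists (H : nat -> @step_process R _ Omega) (g : nat -> R -> R),
  [/\ forall n, adm_step is_cst t T (H n),
      forall n s, step_fun (H n) s = cst (g n s),
      forall n, sqi mu `[t, T[ (g n),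
      ip mu `[t, T[ (g n - f) (g n - f) @[n --> \oo] --> 0 &
      ipP (step_ito (W i) (H n) - X) (step_ito (W i) (H n) - X) @[n --> \oo] --> 0].
Proof.
move=> t0 sf [_ [K [nK cK /mean_square_limP[sK sX cX]]]]; split => //.
have aK n : adm_step (adm_F P F) t T (K n) by exact: nonanticipating_adm.
pose D := (`[t, T[%classic : set (measurableTypeR R)).
have mD : measurable D by rewrite /D; exact: measurable_itv.
have sone : sqi P setT (cst 1 : Omega -> R) := sqi_cst 1 mT (prob_fin P).
pose g n s := ipP (step_fun (K n) s) (cst 1).
exists (fun n => mean_step (K n)), g.
have acst n : adm_step is_cst t T (mean_step (K n)).
  move=> k kn; have [h1 h2 h3 _] := aK n k kn; split => //.
  by exists (ipP (step_val (K n) k) (cst 1)).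
have gE n s : g n s = \sum_(k < step_size (K n))
    ipP (step_val (K n) k) (cst 1) * \1_(`[step_time (K n) k, step_time (K n) k.+1[) s.
  rewrite /g step_funE (ip_suml mT (F := fun k =>
    \1_(`[step_time (K n) k, step_time (K n) k.+1[) s *: step_val (K n) k))//.
    apply: eq_bigr => k _; rewrite ipZl// 1?mulrC//.
    by have [_ _ _ []] := aK n k (ltn_ord k).
  by move=> k kn; apply: sqiZ => //; have [_ _ _ []] := aK n k kn.
have fE n s : step_fun (mean_step (K n)) s = cst (g n s).
  by apply/funext => w; rewrite gE.
have sg n : sqi mu D (g n).
  rewrite (_ : g n = \sum_(k < step_size (K n)) ipP (step_val (K n) k) (cst 1) *:
    (\1_(`[step_time (K n) k, step_time (K n) k.+1[) : R -> R)).
    by apply: sqi_sum => // k _; apply: sqiZ => //; exact: sqi_indic_itv.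
  by apply/funext => s; rewrite gE fct_sumE.
have sKs n s : sqi P setT (step_fun (K n) s) by exact: sqi_step_funF (aK n).
have dec n s : ipP (step_fun (K n) s - cst (g n s)) (step_fun (K n) s - cst (g n s)) +
    (g n s - f s) ^+ 2 = ipP (step_fun (K n) s - cst (f s)) (step_fun (K n) s - cst (f s)).
  exact: mean_best.
have fub n s : ((ipP (step_fun (K n) s - cst (f s)) (step_fun (K n) s - cst (f s)))%:E =
    \int[P]_w ((step_fun (K n) s w - f s) ^+ 2)%:E)%E.
  by rewrite ipE//; apply: sqiB => //; exact: (sqi_cst _ mT (prob_fin P)).
split => //.
  apply: (cvg0_le_EFin _ _ cK) => n; first exact: ip_ge0.
  rewrite ipE//; last exact: sqiB.
  apply: ge0_le_integral_sub.
  - by apply: subset_itvl; rewrite bnd_simp.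
  - by move=> s _; rewrite lee_fin sqr_ge0.
  - by move=> s _; rewrite -fub lee_fin -dec; rewrite lerDr ip_ge0.
  - by move=> s _; apply: integral_ge0 => w _; rewrite lee_fin sqr_ge0.
have aM n : adm_step (adm_F P F) t T (mean_step (K n)).
  by apply: (adm_step_sub t0 _ (acst n)) => u a; exact: is_cst_F.
have cKM : ipP (step_ito (W i) (mean_step (K n)) - step_ito (W i) (K n))
    (step_ito (W i) (mean_step (K n)) - step_ito (W i) (K n)) @[n --> \oo] --> 0.
  apply: (cvg0_le_EFin _ _ cK) => n; first exact: ip_ge0.
  have [ii ->] := isometryF_sub i t0 (aM n) (aK n).
  rewrite EFin_Rintegral//.
  apply: ge0_le_integral_sub.
  - by apply: subset_itvl; rewrite bnd_simp.
  - by move=> s _; rewrite lee_fin ip_ge0.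
  - by move=> s _; rewrite -fub lee_fin -dec fE ip_subC lerDl sqr_ge0.
  - by move=> s _; apply: integral_ge0 => w _; rewrite lee_fin sqr_ge0.
have sM n := sqi_step_itoF i t0 (aM n).
apply: (cvg0_le (v := fun n => 2 * ipP (step_ito (W i) (mean_step (K n)) - step_ito (W i) (K n))
    (step_ito (W i) (mean_step (K n)) - step_ito (W i) (K n)) +
    2 * ipP (step_ito (W i) (K n) - X) (step_ito (W i) (K n) - X))).
- by move=> n; exact: ip_ge0.
- by move=> n; apply: ip_triangleB.
- by apply: cvg0D; exact: cvg0Z.
Qed.

End wiener_steps.

Section wiener_integral.
Context (R : realType) d (Omega : measurableType d) (P : probability Omega R).
Variables (F : R -> set (set Omega)) (m : nat) (W : 'I_m -> R -> Omega -> R).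
Hypotheses (hF : filtration F) (hW : wiener_process P F W).
Local Notation mu := (@lebesgue_measure R).
Local Notation ipP := (ip P setT).
Variables (t T : R).
Hypotheses (t0 : 0 <= t) (tT : t < T).
Local Notation D := (`[t, T[%classic : set R).
Implicit Types (H : @step_process R _ Omega) (i : 'I_m).

Let mT := @measurableT _ Omega.

Let mD : measurable (D : set (measurableTypeR R)).
Proof. exact: measurable_itv. Qed.

(** The approximating sequences are arguments, so that those of several integrals can be
    combined. *)
Definition wiener_approx i (f : R -> R) (X : Omega -> R)
    (K : nat -> step_process) (g : nat -> R -> R) : Prop :=
  [/\ forall n, adm_step (@is_cst _ _ Omega) t T (K n),
      forall n s, step_fun (K n) s = cst (g n s),
      forall n, sqi mu D (g n),
      ip mu D (g n - f) (g n - f) @[n --> \oo] --> 0 &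
      ipP (step_ito (W i) (K n) - X) (step_ito (W i) (K n) - X) @[n --> \oo] --> 0].

Lemma is_cst_adm_F H : adm_step (@is_cst _ _ Omega) t T H -> adm_step (adm_F P F) t T H.
Proof. by apply: (adm_step_sub t0) => u a; exact: (is_cst_F P hF). Qed.

Lemma ip_cst (a b : R) : ipP (cst a) (cst b) = a * b.
Proof. exact: (Rintegral_prob_cst P (a * b)). Qed.

(** The isometry for steps passes to the limit because the inner products on both sides are
    continuous. *)
Lemma wiener_isometry i (f f' : R -> R) X X' (K K' : nat -> step_process)
    (g g' : nat -> R -> R) :
  sqi mu D f -> sqi mu D f' -> sqi P setT X -> sqi P setT X' ->
  wiener_approx i f X K g -> wiener_approx i f' X' K' g' ->
  ipP X X' = ip mu D f f'.
Proof.
move=> sf sf' sX sX' [aH eg sg cg cX] [aH' eg' sg' cg' cX'].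
have sI n := sqi_step_itoF hF hW i t0 (is_cst_adm_F (aH n)).
have sI' n := sqi_step_itoF hF hW i t0 (is_cst_adm_F (aH' n)).
have c1 := cvg_ip mT sI sI' sX sX' cX cX'.
have c2 := cvg_ip mD sg sg' sf sf' cg cg'.
apply: (cvg_unique _ c1) => //.
rewrite (_ : (fun n => _) = (fun n => ip mu D (g n) (g' n)))//.
apply/funext => n.
rewrite (isometryF hF hW i t0 (is_cst_adm_F (aH n)) (is_cst_adm_F (aH' n))).
by apply: eq_Rintegral => s _; rewrite eg eg' ip_cst.
Qed.

Definition one_step (s : R) : @step_process R _ Omega :=
  StepProcess 1 (fun k => if k == 0%N then t else s) (fun=> cst 1).

Lemma step_ito_one_step i s : step_ito (W i) (one_step s) = W i s - W i t.
Proof. by apply/funext => w; rewrite /step_ito/= big_ord1/= mul1r. Qed.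

Lemma step_fun_one_step s u : step_fun (one_step s) u = cst (\1_(`[t, s[) u : R).
Proof. by apply/funext => w; rewrite /step_fun/= big_ord1/= mul1r. Qed.

Lemma wiener_approx_incr i s : t <= s -> s <= T ->
  wiener_approx i \1_(`[t, s[) (W i s - W i t) (fun=> one_step s) (fun=> \1_(`[t, s[)).
Proof.
move=> ts sT; split.
- by move=> n [|]//= _; split => //=; exists 1.
- by move=> n u; rewrite step_fun_one_step.
- by move=> n; exact: sqi_indic_itv.
- by rewrite subrr ip0l; exact: cvg_cst.
- by rewrite step_ito_one_step subrr ip0l; exact: cvg_cst.
Qed.

Lemma sqi_incr i s : t <= s -> sqi P setT (W i s - W i t).
Proof. by move=> ts; have [] := incr_moments hF hW i t0 ts. Qed.

(** The constant 1 is itself a step process, whose integral is the increment; the isometry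
    compares it with any approximation. *)
Lemma ito_one i s X : t <= s -> is_ito P F (W i) t s (fun _ _ => 1) X ->
  sqi P setT X /\ ipP (X - (W i s - W i t)) (X - (W i s - W i t)) = 0.
Proof.
move=> ts [_ [K [nK cK /mean_square_limP[sK sX cX]]]]; split => //.
have aK n : adm_step (adm_F P F) t s (K n) by exact: nonanticipating_adm.
have a1 : adm_step (adm_F P F) t s (one_step s).
  move=> [|]//= _; split => //=; exact: adm_F_cst.
have sI n := sqi_step_itoF hF hW i t0 (aK n).
have sW := sqi_incr i ts.
have cW : ipP (step_ito (W i) (K n) - (W i s - W i t))
    (step_ito (W i) (K n) - (W i s - W i t)) @[n --> \oo] --> 0.
  apply: (cvg0_le_EFin _ _ cK) => n; first exact: ip_ge0.
  have [ii] := isometryF_sub hF hW i t0 (aK n) a1.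
  rewrite step_ito_one_step => ->; rewrite EFin_Rintegral//.
  apply: ge0_le_integral_sub.
  - by apply: subset_itvl; rewrite bnd_simp.
  - by move=> u _; rewrite lee_fin ip_ge0.
  - move=> u us; rewrite step_fun_one_step indicE mem_set// ipE//.
    apply: sqiB => //; first exact: sqi_step_funF (aK n).
    exact: (sqi_cst _ mT (prob_fin P)).
  - by move=> u _; apply: integral_ge0 => w _; rewrite lee_fin sqr_ge0.
apply/eqP; rewrite eq_le ip_ge0 andbT.
have c0 := cvg0D (cvg0Z 2 cX) (cvg0Z 2 cW).
apply: (cvgr_to_ge c0); apply: nearW => n.
apply: le_trans (ip_triangleB mT sX sW (sI n)) _.
by rewrite (ip_subC _ _ X).
Qed.


(** * The iterated integral as a limit of sums over grids *)

Definition grid (N l : nat) : R := t + l%:R * ((T - t) / N.+1%:R).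

(** The increment from [t], frozen on each cell at its value at the left end. *)
Definition grid_step i (N : nat) : @step_process R _ Omega :=
  StepProcess N.+1 (grid N) (fun l => W i (grid N l) - W i t).

Lemma grid_mesh_gt0 (N : nat) : 0 < (T - t) / N.+1%:R.
Proof. by rewrite divr_gt0// subr_gt0. Qed.

Lemma grid_le (N k l : nat) : (k <= l)%N -> grid N k <= grid N l.
Proof. by move=> kl; rewrite lerD2l ler_wpM2r ?ler_nat// ltW// grid_mesh_gt0. Qed.

Lemma grid0 N : grid N 0 = t.
Proof. by rewrite /grid mul0r addr0. Qed.

Lemma gridN N : grid N N.+1 = T.
Proof. by rewrite /grid mulrC divfK ?pnatr_eq0// addrC subrK. Qed.

Lemma gridS N l : grid N l.+1 = grid N l + (T - t) / N.+1%:R.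
Proof. by rewrite /grid -natr1; ring. Qed.

Lemma grid_cell (N k : nat) s : t <= s -> s < grid N k ->
  exists l, [/\ (l < k)%N, grid N l <= s & s < grid N l.+1].
Proof.
move=> ts; elim: k => [|k ih]; first by rewrite grid0 ltNge ts.
have [ks sk|/ih[l [lk h1 h2]] _] := leP (grid N k) s; first by exists k.
by exists l; split => //; exact: ltnW.
Qed.

Lemma step_fun_grid i N s l : (l < N.+1)%N -> grid N l <= s -> s < grid N l.+1 ->
  step_fun (grid_step i N) s = W i (grid N l) - W i t.
Proof.
move=> lN ls sl; apply/funext => w; rewrite /step_fun/= (bigD1 (Ordinal lN))//= big1.
  by rewrite addr0 indicE mem_set ?mulr1//= in_itv/= ls.
move=> k kl; rewrite indicE memNset ?mulr0//= in_itv/= => /andP[ks sk].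
have {}kl : (k : nat) != l by apply: contra kl => /eqP e; apply/eqP/val_inj.
move: kl; rewrite neq_ltn => /orP[kl|lk].
  by have := lt_le_trans sk (le_trans (grid_le N kl) ls); rewrite ltxx.
by have := lt_le_trans sl (le_trans (grid_le N lk) ks); rewrite ltxx.
Qed.

Lemma grid_itv N l : (l < N.+1)%N ->
  [/\ t <= grid N l, grid N l <= grid N l.+1 & grid N l.+1 <= T].
Proof.
move=> lN; split; [|exact: grid_le|by rewrite -[leRHS](gridN N); exact: grid_le].
by rewrite -(grid0 N); exact: grid_le.
Qed.

Lemma grid_adm_F i N : adm_step (adm_F P F) t T (grid_step i N).
Proof.
move=> l lN; have [h1 h2 h3] := grid_itv lN; split => //=; split.
  exact: (incr_wrt hF hW).
exact: sqi_incr.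
Qed.

Lemma grid_adm_S i N : adm_step (adm_S P W i) t T (grid_step i N).
Proof.
move=> l lN; have [h1 h2 h3] := grid_itv lN; split => //=; split.
  by apply: incr_sigma_process => //; exact: le_trans h1.
exact: sqi_incr.
Qed.

Lemma grid_error i N s : t <= s -> s < T ->
  ipP (step_fun (grid_step i N) s - (W i s - W i t))
      (step_fun (grid_step i N) s - (W i s - W i t)) <= (T - t) / N.+1%:R.
Proof.
move=> ts sT; have [|l [lN ls sl]] := @grid_cell N N.+1 s ts; first by rewrite gridN.
rewrite (step_fun_grid i lN ls sl).
have [tl _ _] := grid_itv lN; have l0 := le_trans t0 tl.
rewrite (_ : _ - _ = - (W i s - W i (grid N l))); last first.
  by rewrite !opprB addrA subrK.
have [sW _ eW] := incr_moments hF hW i l0 ls.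
rewrite (ipNl mT sW (sqiN mT sW)) (ipNr mT sW sW) opprK eW.
by rewrite lerBlDl -gridS ltW.
Qed.

(** By [ito_one] the inner integral is the increment [W i1 s - W i1 t], which the grid steps
    approximate. The isometry compares these steps with those that define the outer integral.
    Their values depend on [W i1] only, so they are admissible for [adm_S] too. *)
Lemma iterated_ito_grid i1 i2 Y I2 :
  (forall s, s \in `[t, T] -> is_ito P F (W i1) t s (fun _ _ => 1) (Y s)) ->
  is_ito P F (W i2) t T Y I2 ->
  sqi P setT I2 /\ ipP (step_ito (W i2) (grid_step i1 n) - I2)
    (step_ito (W i2) (grid_step i1 n) - I2) @[n --> \oo] --> 0.
Proof.
move=> iY [_ [K [nK cK /mean_square_limP[sK sX cX]]]]; split => //.
have aK n : adm_step (adm_F P F) t T (K n) by exact: nonanticipating_adm.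
have aG n := @grid_adm_F i1 n.
pose g n s := (\int[P]_w ((step_fun (K n) s w - Y s w) ^+ 2)%:E)%E.
have g0 n s : (0 <= g n s)%E by apply: integral_ge0 => w _; rewrite lee_fin sqr_ge0.
have bnd n s : D s -> ((ipP (step_fun (grid_step i1 n) s - step_fun (K n) s)
    (step_fun (grid_step i1 n) s - step_fun (K n) s))%:E <=
    (2 * ((T - t) / n.+1%:R))%:E + 4%:E * g n s)%E.
  rewrite /= in_itv/= => /andP[ts sT].
  have sc : s \in `[t, T] by rewrite in_itv/= ts ltW.
  have [sY eY] := ito_one ts (iY s sc).
  have sW := sqi_incr i1 ts.
  have sG := sqi_step_funF s (aG n); have sKs := sqi_step_funF s (aK n).
  rewrite /g (_ : \int[P]_w _ = (ipP (step_fun (K n) s - Y s) (step_fun (K n) s - Y s))%:E)%E;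
    last by rewrite ipE//; exact: sqiB.
  rewrite -EFinM -EFinD lee_fin.
  apply: le_trans (ip_triangleB mT sG sKs sW) _.
  apply: lerD; first by apply: ler_wpM2l => //; exact: grid_error.
  have -> : 4 = 2 * 2 :> R by rewrite -natrM.
  rewrite -mulrA ler_wpM2l//.
  rewrite (ip_subC _ _ (W i1 s - W i1 t)).
  by apply: le_trans (ip_triangleB mT sKs sW sY) _; rewrite eY mulr0 addr0.
have sI n := sqi_step_itoF hF hW i2 t0 (aK n).
have sJ n := sqi_step_itoF hF hW i2 t0 (aG n).
have c1 : ipP (step_ito (W i2) (grid_step i1 n) - step_ito (W i2) (K n))
    (step_ito (W i2) (grid_step i1 n) - step_ito (W i2) (K n)) @[n --> \oo] --> 0.
  apply: (cvg0_le_EFin (v := fun n => ((2 * ((T - t) / n.+1%:R))%:E * mu D +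
    4%:E * \int[mu]_(s in `[t, T]) g n s)%E)) => [n|n|]; first exact: ip_ge0.
    have [ii ->] := isometryF_sub hF hW i2 t0 (aG n) (aK n).
    rewrite EFin_Rintegral//.
    apply: le_trans (integral_le_affine mu (C := 4) mD _ _ _ _ _ (bnd n)) _ => //.
    - by apply/measurable_EFinP; exact: measurable_int ii.
    - by move=> s; exact: ip_ge0.
    - by rewrite mulr_ge0// ltW// grid_mesh_gt0.
    rewrite leeD2l// lee_wpmul2l//; apply: ge0_le_integral_sub => //.
    by apply: subset_itvl; rewrite bnd_simp.
  rewrite -[X in _ --> X](adde0 0%E); apply: cvgeD => //; last first.
    by rewrite -[X in _ --> X](mule0 4%:E); apply: cvgeZl.
  rewrite lebesgue_measure_itv/= lte_fin tT -EFinD.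
  rewrite (_ : (fun n => _) = (fun n => (2 * (T - t) ^+ 2 * n.+1%:R^-1)%:E)); last first.
    by apply/funext => n; rewrite -EFinM; congr EFin; ring.
  by apply: cvg_EFin; [exact: nearW|apply: cvg0Z; exact: cvg_harmonic].
apply: (cvg0_le _ _ (cvg0D (cvg0Z 2 c1) (cvg0Z 2 cX))) => n; first exact: ip_ge0.
exact: ip_triangleB.
Qed.
End wiener_integral.

(** * The error of a partial sum of the expansion *)

(** A product of two integrals of nonrandom steps is an integral of one step process, with
    values that depend on the first factor ([step_ito_mul]). *)
Definition mul_step (R : realType) d (Omega : measurableType d)
    (H : @step_process R _ Omega) (X : Omega -> R) : @step_process R _ Omega :=
  StepProcess (step_size H) (step_time H) (fun k w => X w * step_val H k w).

Lemma step_fun_mul (R : realType) d (Omega : measurableType d)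
    (H : @step_process R _ Omega) (X : Omega -> R) s w :
  step_fun (mul_step H X) s w = X w * step_fun H s w.
Proof. by rewrite /step_fun mulr_sumr; apply: eq_bigr => k _; rewrite mulrA. Qed.

Lemma step_ito_mul (R : realType) d (Omega : measurableType d) (B : R -> Omega -> R)
    (H : @step_process R _ Omega) (X : Omega -> R) w :
  step_ito B (mul_step H X) w = X w * step_ito B H w.
Proof. by rewrite /step_ito mulr_sumr; apply: eq_bigr => k _; rewrite mulrA. Qed.

Section expansion.
Context (R : realType) d (Omega : measurableType d) (P : probability Omega R).
Variables (F : R -> set (set Omega)) (m : nat) (W : 'I_m -> R -> Omega -> R).
Hypotheses (hF : filtration F) (hW : wiener_process P F W).
Local Notation mu := (@lebesgue_measure R).
Local Notation ipP := (ip P setT).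
Variables (t T : R) (i1 i2 : 'I_m).
Hypotheses (t0 : 0 <= t) (tT : t < T) (i12 : i1 != i2).
Local Notation D := (`[t, T[%classic : set R).
Implicit Types (H : @step_process R _ Omega).

Let mT := @measurableT _ Omega.

Let mD : measurable (D : set (measurableTypeR R)).
Proof. exact: measurable_itv. Qed.

Lemma mul_step_adm H H' : adm_step (@is_cst _ _ Omega) t T H ->
  adm_step (@is_cst _ _ Omega) t T H' ->
  adm_step (adm_S P W i1) t T (mul_step H (step_ito (W i1) H')).
Proof.
move=> aH aH' k kn; have [h1 h2 h3 [c hc]] := aH k kn; split => //=.
have sX := sqi_step_itoF hF hW i1 t0 (is_cst_adm_F P hF t0 aH').
have e : (fun w => step_ito (W i1) H' w * step_val H k w) = c *: step_ito (W i1) H'.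
  by apply/funext => w; rewrite hc mulrC.
rewrite e; split; last exact: sqiZ.
apply: wrtZ; first exact: sigma_process_algebra.
rewrite step_itoE; apply: (wrt_sum (X := fun k => ito_inc (W i1) (step_val H' k)
  (step_time H' k) (step_time H' k.+1))); first exact: sigma_process_algebra.
move=> l ln; have [g1 g2 g3 [b ->]] := aH' l ln; have l0 := le_trans t0 g1.
apply: wrtM; first exact: sigma_process_algebra.
  by apply: wrt_cst; exact: sigma_process_algebra.
by apply: incr_sigma_process => //; exact: le_trans g2.
Qed.

(** Write [a *: X - b *: Y] as [(a - b) *: X + b *: (X - Y)]. *)
Lemma ip_diff_mul (a b : R) (X Y : Omega -> R) : sqi P setT X -> sqi P setT Y ->
  ipP (a *: X - b *: Y) (a *: X - b *: Y) <=
  2 * ipP X X * (a - b) ^+ 2 + 2 * ipP (X - Y) (X - Y) * b ^+ 2.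
Proof.
move=> sX sY.
have -> : a *: X - b *: Y = (a - b) *: X + b *: (X - Y).
  by rewrite scalerBl scalerBr addrA subrK.
have sXY := sqiB mT sX sY.
apply: le_trans (ip_triangle mT (sqiZ mT _ sX) (sqiZ mT _ sXY)) _.
rewrite !ipZl ?ipZr//; [|exact: sqiZ..].
by rewrite le_eqVlt; apply/orP; left; apply/eqP; ring.
Qed.


Section bound.
Variables (q : nat) (phi Phi : nat -> R -> R) (xi eta : nat -> Omega -> R) (I2 : Omega -> R).
Variables (A B : nat -> nat -> @step_process R _ Omega) (ga gb : nat -> nat -> R -> R).
Hypotheses (sPhi : forall j, sqi mu D (Phi j)).
Hypotheses (sxi : forall j, sqi P setT (xi j)) (seta : forall j, sqi P setT (eta j)).
Hypothesis aA : forall j, wiener_approx P W t T i1 (phi j) (xi j) (A j) (ga j).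
Hypothesis aB : forall j, wiener_approx P W t T i2 (Phi j) (eta j) (B j) (gb j).
Hypothesis sI : sqi P setT I2.
Hypothesis cI : ipP (step_ito (W i2) (grid_step W t T i1 n) - I2)
    (step_ito (W i2) (grid_step W t T i1 n) - I2) @[n --> \oo] --> 0.

(** The integrand whose integral against [W i2] is the error of the expansion. *)
Let V s : Omega -> R := \sum_(j < q) Phi j s *: xi j - (W i1 s - W i1 t).

Hypothesis iV : mu.-integrable D (EFin \o (fun s => ipP (V s) (V s))).

Let X n j := step_ito (W i1) (A j n).
Let H n j := mul_step (B j n) (X n j).
Let G n := grid_step W t T i1 n.
Let Dn n : Omega -> R := \sum_(j < q) step_ito (W i2) (H n j) - step_ito (W i2) (G n).
Let fn n s : Omega -> R := \sum_(j < q) step_fun (H n j) s - step_fun (G n) s.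

Let aAn j n : adm_step (@is_cst _ _ Omega) t T (A j n). Proof. by case: (aA j). Qed.
Let aBn j n : adm_step (@is_cst _ _ Omega) t T (B j n). Proof. by case: (aB j). Qed.

Let aH n j : adm_step (adm_S P W i1) t T (H n j).
Proof. exact: mul_step_adm. Qed.

Let aG n : adm_step (adm_S P W i1) t T (G n).
Proof. exact: (grid_adm_S hF hW t0 tT). Qed.

Let sX n j : sqi P setT (X n j).
Proof. exact: (sqi_step_itoF hF hW i1 t0 (is_cst_adm_F P hF t0 (@aAn j n))). Qed.

Let sS n j : sqi P setT (step_ito (W i2) (B j n)).
Proof. exact: (sqi_step_itoF hF hW i2 t0 (is_cst_adm_F P hF t0 (@aBn j n))). Qed.

Let sGI n : sqi P setT (step_ito (W i2) (G n)).
Proof. apply: (sqi_step_itoF hF hW i2 t0); exact: (grid_adm_F hF hW t0 tT). Qed.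

Let fnE n s : fn n s = \sum_(j < q) gb j n s *: X n j - step_fun (G n) s.
Proof.
congr (_ - _); apply: eq_bigr => j _; apply/funext => w.
by rewrite step_fun_mul; have [_ -> _ _ _] := aB j; rewrite mulrC.
Qed.

Let x n j := ipP (X n j) (X n j).
Let e n j := ipP (X n j - xi j) (X n j - xi j).
Let h n s := \sum_(j < q) (2 * x n j * ((gb j n - Phi j) s) ^+ 2 + 2 * e n j * Phi j s ^+ 2).

Let fn_le n s : D s -> ipP (fn n s) (fn n s) <=
  4 * ((T - t) / n.+1%:R) + 4 * q%:R * h n s + 2 * ipP (V s) (V s).
Proof.
rewrite /= in_itv/= => /andP[ts sT].
have sW := sqi_incr hF hW t0 i1 ts.
have sG : sqi P setT (step_fun (G n) s) by apply: sqi_step_funF; exact: (grid_adm_F hF hW t0 tT).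
(* [U] is the error on the coefficients, [E] the discretization error of the grid. *)
pose U : Omega -> R := \sum_(j < q) (gb j n s *: X n j - Phi j s *: xi j).
have sV : sqi P setT (V s).
  by apply: sqiB => //; apply: sqi_sum => // j _; exact: sqiZ.
have sU j : sqi P setT (gb j n s *: X n j - Phi j s *: xi j) by apply: sqiB => //; exact: sqiZ.
have sU' : sqi P setT U by exact: sqi_sum.
pose E : Omega -> R := step_fun (G n) s - (W i1 s - W i1 t).
have sE : sqi P setT E by exact: sqiB.
have eE : fn n s = (U - E) + V s.
  rewrite fnE /U /E /V sumrB; move: (\sum_(_ < q) _) (\sum_(_ < q) _) => S1 S2.
  by apply/funext => w; rewrite !(addrfctE, opprfctE); ring.
rewrite eE.
apply: le_trans (ip_triangle mT (sqiB mT sU' sE) sV) _; rewrite lerD2r.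
have h1 := ip_triangle mT sU' (sqiN mT sE).
rewrite (ipNl mT sE (sqiN mT sE)) (ipNr mT sE sE) opprK in h1.
have h2 : ipP E E <= (T - t) / n.+1%:R by exact: (grid_error hF hW t0 tT).
have h3 : ipP U U <= q%:R * h n s.
  apply: le_trans (ip_sum_le mT (n := q)
    (F := fun j => gb j n s *: X n j - Phi j s *: xi j) _) _ => //.
  rewrite ler_wpM2l//; apply: ler_sum => j _; exact: ip_diff_mul.
apply: le_trans (ler_wpM2l _ h1) _ => //.
rewrite -[4 * q%:R * _]mulrA; clear h1; move: h2 h3.
by move: (ipP U U) (ipP E E) (q%:R * h n s) ((T - t) / n.+1%:R) => a b c' c h2 h3; lra.
Qed.


Let eps n j := ip mu D (gb j n - Phi j) (gb j n - Phi j).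

Let sgb j n : sqi mu D (gb j n - Phi j).
Proof. by apply: sqiB => //; case: (aB j). Qed.

Let int_scale (a : R) (f : R -> R) : sqi mu D f ->
  mu.-integrable D (EFin \o (fun s => a * f s ^+ 2)) /\
  \int[mu]_(s in D) (a * f s ^+ 2) = a * ip mu D f f.
Proof.
move=> sf; have i := sqi_integrable sf; split.
  by have := integrableZl mD a i; apply: eq_integrable.
by rewrite RintegralZl.
Qed.

Let int_h n : mu.-integrable D (EFin \o h n) /\
  \int[mu]_(s in D) h n s =
  \sum_(j < q) (2 * x n j * eps n j + 2 * e n j * ip mu D (Phi j) (Phi j)).
Proof.
pose k j s := 2 * x n j * ((gb j n - Phi j) s) ^+ 2 + 2 * e n j * Phi j s ^+ 2.
have ik j : mu.-integrable D (EFin \o k j) /\ \int[mu]_(s in D) k j s =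
    2 * x n j * eps n j + 2 * e n j * ip mu D (Phi j) (Phi j).
  have [a1 b1] := int_scale (2 * x n j) (@sgb j n).
  have [a2 b2] := int_scale (2 * e n j) (sPhi j).
  split; last by rewrite /k (RintegralD mD)// b1 b2.
  by have := integrableD mD a1 a2; apply: eq_integrable.
have [ii ->] := Rintegral_sum mD (fun j (_ : (j < q)%N) => (ik j).1).
by split => //; apply: eq_bigr => j _; exact: (ik j).2.
Qed.

Let c n := 4 * ((T - t) / n.+1%:R) * (T - t) +
  4 * q%:R * \sum_(j < q) (2 * x n j * eps n j + 2 * e n j * ip mu D (Phi j) (Phi j)) +
  2 * \int[mu]_(s in D) ipP (V s) (V s).

Let Dn_le n : (\int[P]_w (Dn n w ^+ 2)%:E <= (c n)%:E)%E.
Proof.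
have sD : sqi P setT (Dn n).
  apply: sqiB => //; apply: sqi_sum => // j _.
  exact: (sqi_step_ito t0 (sqi_ito_inc_S hF hW i12) (@aH n j)).
rewrite -ipE// lee_fin.
have [ii eD] := @ito_isometry_sum _ _ _ P (W i2) (adm_S P W i1) t T t0
  (fun u a h => h.2) (sqi_ito_inc_S hF hW i12) (ito_inc_pair_S hF hW i12) q (H n) (G n)
  (fun j _ => @aH n j) (@aG n).
rewrite {1 2}/Dn eD.
have [ih eh] := int_h n.
have mu_D : (mu D < +oo)%E := itv_co_fin t T.
pose a : R := 4 * ((T - t) / n.+1%:R).
have ia : mu.-integrable D (EFin \o (fun=> a)) := sqi_int mD mu_D (sqi_cst a mD mu_D).
have ibh : mu.-integrable D (EFin \o (fun s => 4 * q%:R * h n s)).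
  by have := integrableZl mD (4 * q%:R) ih; apply: eq_integrable.
have ivh : mu.-integrable D (EFin \o (fun s => 2 * ipP (V s) (V s))).
  by have := integrableZl mD 2 iV; apply: eq_integrable.
have iab : mu.-integrable D (EFin \o (fun s => a + 4 * q%:R * h n s)).
  by have := integrableD mD ia ibh; apply: eq_integrable.
have iabv : mu.-integrable D (EFin \o (fun s => a + 4 * q%:R * h n s + 2 * ipP (V s) (V s))).
  by have := integrableD mD iab ivh; apply: eq_integrable.
apply: le_trans (le_Rintegral mD ii iabv _) _ => [s Ds|]; first exact: fn_le.
rewrite (RintegralD mD iab ivh) (RintegralD mD ia ibh).
rewrite (RintegralZl _ mD ih) (RintegralZl _ mD iV) eh.
rewrite (Rintegral_cst _ mD)// lebesgue_itv_co max_r // subr_ge0; exact: ltW.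
Qed.

Let cvg_c : c n @[n --> \oo] --> 2 * \int[mu]_(s in D) ipP (V s) (V s).
Proof.
rewrite -[X in _ --> X]add0r; apply: cvgD; last exact: cvg_cst.
apply: cvg0D.
  rewrite (_ : (fun n => _) = (fun n => 4 * (T - t) ^+ 2 * n.+1%:R^-1)).
    by apply: cvg0Z; exact: cvg_harmonic.
  by apply/funext => n; ring.
apply: cvg0Z; apply: (@cvg0_sum R q (fun j n =>
  2 * x n j * eps n j + 2 * e n j * ip mu D (Phi j) (Phi j))) => j; apply: cvg0D.
  have [_ _ _ ceps _] := aB j; have [_ _ _ _ cx] := aA j.
  have cx' := cvg_ip mT (fun n => @sX n j) (fun n => @sX n j) (sxi j) (sxi j) cx cx.
  rewrite (_ : (fun n => _) = (fun n => 2 * (x n j * eps n j))); last first.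
    by apply/funext => n; rewrite mulrA.
  apply: cvg0Z; rewrite -[X in _ --> X](mulr0 (ipP (xi j) (xi j))); exact: cvgM.
have [_ _ _ _ cx] := aA j.
rewrite (_ : (fun n => _) = (fun n => 2 * ip mu D (Phi j) (Phi j) * e n j)); last first.
  by apply/funext => n; ring.
exact: cvg0Z.
Qed.

(** The approximations [Dn n] of the error converge to it in mean, and their second moments are
    bounded by [c n], whose limit is the right-hand side. *)
Lemma expansion_error_le :
  (\int[P]_w ((\sum_(j < q) xi j w * eta j w - I2 w) ^+ 2)%:E <=
   (2 * \int[mu]_(s in D) ipP (V s) (V s))%:E)%E.
Proof.
have s1 : sqi P setT (cst 1 : Omega -> R) := sqi_cst 1 mT (prob_fin P).
have c1 : ipP ((cst 1 : Omega -> R) - cst 1) (cst 1 - cst 1) @[_ --> \oo] --> 0.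
  by rewrite subrr ip0l; exact: cvg_cst.
have [dI hI cdI] := cvg_mul_mean mT sGI (fun=> s1) sI s1 cI c1.
have /choice[dl hdl] : forall j : nat, exists dj : nat -> R,
    (forall n, (\int[P]_w `|X n j w * step_ito (W i2) (B j n) w - xi j w * eta j w|%:E
      <= (dj n)%:E)%E) /\ dj n @[n --> \oo] --> 0.
  move=> j; have [_ _ _ _ cx] := aA j; have [_ _ _ _ ce] := aB j.
  have [dj h1 h2] := cvg_mul_mean mT (fun n => @sX n j) (fun n => @sS n j) (sxi j) (seta j) cx ce.
  by exists dj.
have mX n j : measurable_fun setT (fun w => X n j w * step_ito (W i2) (B j n) w).
  by apply: measurable_funM; [case: (@sX n j)|case: (@sS n j)].
have mxi j : measurable_fun setT (fun w => xi j w * eta j w).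
  by apply: measurable_funM; [case: (sxi j)|case: (seta j)].
have DnE n : Dn n = fun w => \sum_(j < q) X n j w * step_ito (W i2) (B j n) w -
    step_ito (W i2) (G n) w.
  apply/funext => w; rewrite /Dn addrfctE opprfctE fct_sumE; congr (_ - _).
  by apply: eq_bigr => j _; rewrite step_ito_mul.
have mDn n : measurable_fun setT (Dn n).
  rewrite DnE; apply: measurable_funB; last by case: (sGI n).
  exact: measurable_sum.
apply: (sqr_integral_le_lim (X_ := Dn) (c_ := c)
  (delta := fun n => \sum_(j < q) dl j n + dI n)) => //.
- by apply: measurable_funB; [exact: measurable_sum|case: sI].
- move=> n; rewrite EFinD -sumEFin.
  apply: (@le_trans _ _ (\int[P]_w (\sum_(j < q)
     `|X n j w * step_ito (W i2) (B j n) w - xi j w * eta j w|%:E +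
     `|step_ito (W i2) (G n) w * cst 1 w - I2 w * cst 1 w|%:E))%E).
    apply: ge0_le_integral_nomeas => w _; first by rewrite lee_fin.
    rewrite sumEFin -EFinD lee_fin DnE !mulr1.
    have -> : \sum_(j < q) X n j w * step_ito (W i2) (B j n) w -
        step_ito (W i2) (G n) w - (\sum_(j < q) xi j w * eta j w - I2 w) =
        \sum_(j < q) (X n j w * step_ito (W i2) (B j n) w - xi j w * eta j w) -
        (step_ito (W i2) (G n) w - I2 w) by rewrite sumrB; ring.
    apply: le_trans (ler_normB _ _) _; rewrite lerD2r; exact: ler_norm_sum.
  have mabs j : measurable_fun setT
      (fun w => `|X n j w * step_ito (W i2) (B j n) w - xi j w * eta j w|%:E).
    by apply/measurable_EFinP; apply: measurableT_comp => //; exact: measurable_funB.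
  rewrite ge0_integralD//; last 3 first.
  - by move=> w _; apply: sume_ge0 => j _; rewrite lee_fin.
  - exact: emeasurable_sum.
  - apply/measurable_EFinP; apply: measurableT_comp => //; apply: measurable_funB.
      by apply: measurable_funM => //; case: (sGI n).
    by apply: measurable_funM => //; case: sI.
  apply: leeD => //.
  rewrite ge0_integral_sum//; apply: lee_sum => j _; exact: (hdl j).1.
- by apply: cvg0D => //; apply: cvg0_sum => j; exact: (hdl j).2.
Qed.

End bound.
End expansion.

(** * Fourier remainders of indicators of intervals *)

Section interval.
Context (R : realType).
Local Notation mu := (@lebesgue_measure R).
Variables (t T : R).
Local Notation D := (`[t, T[%classic : set R).

Let mD : measurable (D : set (measurableTypeR R)).
Proof. exact: measurable_itv. Qed.

Lemma sqi_itv_co f : sqi mu `[t, T] f -> sqi mu D f.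
Proof. by apply: sqi_subset => //; apply: subset_itvl; rewrite bnd_simp. Qed.

Lemma ip_itv_cc f g : sqi mu D f -> sqi mu D g ->
  ip mu D f g = \int[mu]_(x in `[t, T]) (f x * g x).
Proof. by move=> sf sg; rewrite /ip Rintegral_itv_bndo_bndc//; exact: sqi_mul. Qed.

Lemma L2_on_indic u v : L2_on t T (\1_(`[u, v[%classic : set R) : R -> R).
Proof.
split; first exact: measurable_indic.
apply: (@le_lt_trans _ _ (\int[mu]_(x in `[t, T]) (cst 1%E x))%E).
  apply: ge0_le_integral_nomeas => x _; first by rewrite lee_fin sqr_ge0.
  by rewrite lee_fin /= indicE; case: (_ \in _); rewrite ?expr1n ?expr0n.
rewrite integral_cst//= mul1e lebesgue_measure_itv/=.
by case: ifP => _; rewrite -?EFinD ltry.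
Qed.

Lemma ip_indic_primitive f s : t <= s -> s < T -> sqi mu D f ->
  ip mu D f \1_(`[t, s[%classic : set R) = \int[mu]_(x in `[t, s]) f x.
Proof.
move=> ts sT sf.
have sub : (`[t, s[%classic : set R) `<=` D by apply: subset_itvl; rewrite bnd_simp ltW.
have fi : mu.-integrable D (EFin \o f) := sqi_int mD (itv_co_fin t T) sf.
rewrite -Rintegral_itv_bndo_bndc; last exact: integrableS fi.
rewrite /ip [RHS]Rintegral_mkcond [LHS]Rintegral_mkcond.
apply: eq_Rintegral => x _; rewrite !patchE indicE.
have [xs|xs] := boolP (x \in `[t, s[%classic).
  by rewrite mem_set ?mulr1//; apply/sub; exact: set_mem.
by rewrite mulr0; case: ifP.
Qed.

End interval.

Section parseval_interval.
Context (R : realType).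
Local Notation mu := (@lebesgue_measure R).
Variables (t T : R) (phi : nat -> R -> R).
Hypothesis tT : t < T.
Hypothesis cphi : complete_orthonormal_system t T phi.
Local Notation D := (`[t, T[%classic : set R).
Local Notation Phi := (fun j s => \int[mu]_(x in `[t, s]) phi j x).

Let mD : measurable (D : set (measurableTypeR R)).
Proof. exact: measurable_itv. Qed.

Lemma cons_sqi j : sqi mu D (phi j).
Proof. by apply: sqi_itv_co; case: cphi => + _ _; apply. Qed.

Lemma cons_orth j k : ip mu D (phi j) (phi k) = (j == k)%:R.
Proof. by rewrite ip_itv_cc; [case: cphi|exact: cons_sqi..]. Qed.

Let ind s : R -> R := \1_(`[t, s[%classic : set R).

Let ip_ind s : t <= s -> s < T -> ip mu D (ind s) (ind s) = s - t.
Proof.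
move=> ts sT; have sT' := ltW sT.
by rewrite ip_indic_itv// /overlap minxx maxxx max_r// subr_ge0.
Qed.

Let remE s n : D s -> s - t - \sum_(j < n) Phi j s ^+ 2 =
  ip mu D (ind s) (ind s) - \sum_(j < n) ip mu D (phi j) (ind s) ^+ 2.
Proof.
rewrite /= in_itv/= => /andP[ts sT]; rewrite ip_ind//; congr (_ - _).
by apply: eq_bigr => j _; rewrite ip_indic_primitive//; exact: cons_sqi.
Qed.

Lemma remainder_ge0 s n : D s -> 0 <= s - t - \sum_(j < n) Phi j s ^+ 2.
Proof.
move=> Ds; rewrite remE//; apply: bessel => //; [exact: cons_sqi|exact: sqi_indic_itv|].
exact: cons_orth.
Qed.

Lemma remainder_cvg s : D s -> s - t - \sum_(j < n) Phi j s ^+ 2 @[n --> \oo] --> 0.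
Proof.
move=> Ds; under eq_cvg do rewrite remE//.
apply: parseval => //; [exact: cons_sqi|exact: sqi_indic_itv|exact: cons_orth|].
move=> e e0; have [_ _ dense] := cphi.
have [n [c h]] := dense _ (L2_on_indic t T t s) e e0.
exists n, c => /=; rewrite -lte_fin ipE//; last first.
  apply: sqiB => //; first exact: sqi_indic_itv.
  by apply: sqi_sum => // j _; apply: sqiZ => //; exact: cons_sqi.
apply: le_lt_trans h; apply: ge0_le_integral_sub => [|x _|x _|x _].
- by apply: subset_itvl; rewrite bnd_simp.
- by rewrite lee_fin sqr_ge0.
- by rewrite lee_fin addrfctE opprfctE fct_sumE.
- by rewrite lee_fin sqr_ge0.
Qed.

(** At each time the remainder tends to 0 by Parseval's identity, and Bessel's inequality bounds
    it by [T - t]. *)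
Lemma remainder_integral_cvg : (forall j, sqi mu D (Phi j)) ->
  (forall n, mu.-integrable D (EFin \o (fun s => s - t - \sum_(j < n) Phi j s ^+ 2))) /\
  \int[mu]_(s in D) (s - t - \sum_(j < n) Phi j s ^+ 2) @[n --> \oo] --> 0.
Proof.
move=> sPhi; pose r n s : R := s - t - \sum_(j < n) Phi j s ^+ 2.
have mr n : measurable_fun D (r n).
  apply: measurable_funB.
    by apply: measurable_funB => //; exact: measurable_cst.
  by apply: measurable_sum => j; apply: measurable_funX; case: (sPhi j).
have mrE n : measurable_fun D (EFin \o r n).
  by apply/measurable_EFinP; exact: mr.
have mu_D : (mu D < +oo)%E := itv_co_fin t T.
have ib : mu.-integrable D (EFin \o (fun=> T - t)) :=
  sqi_int mD mu_D (sqi_cst (T - t) mD mu_D).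
have bnd n s : D s -> `|r n s| <= T - t.
  move=> Ds; rewrite ger0_norm; last exact: remainder_ge0.
  move: Ds; rewrite /= in_itv/= => /andP[_ sT].
  rewrite /r lerBlDr (le_trans (lerB (ltW sT) (lexx t)))// lerDl.
  by apply: sumr_ge0 => j _; exact: sqr_ge0.
have ir n : mu.-integrable D (EFin \o r n).
  apply: (le_integrable mD (mrE n) _ ib).
  move=> s Ds /=; rewrite lee_fin (le_trans (bnd n s Ds))// ler_norm//.
split => //.
have h := @dominated_cvg _ _ R mu D mD (fun n => EFin \o r n) (cst 0%E) (fun=> (T - t)%:E).
have {h} := h mrE.
rewrite integral0 => h; apply: (@fine_cvg _ _ _ _ _ 0).
apply: h => //.
by move=> s Ds; apply: cvg_EFin; [exact: nearW|exact: remainder_cvg].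
Qed.

End parseval_interval.

(** * The expansion *)

Lemma nonanticipating_sqi (R : realType) d (Omega : measurableType d) (P : probability Omega R)
    (F : R -> set (set Omega)) (t T : R) (f : R -> R) :
  nonanticipating P F t T (fun s _ => f s) -> sqi (@lebesgue_measure R) `[t, T] f.
Proof.
move=> [mf _ fi]; split.
  have mp : measurable_fun (`[t, T] : set (measurableTypeR R))
      (fun s : measurableTypeR R => (s, (point : Omega))).
    by apply: measurable_funTS; exact: measurable_pair2.
  apply: (measurable_comp _ _ mf mp) => //.
    by apply: measurableX => //; exact: measurable_itv.
  by move=> _ [s ts <-].
have e s : ((f s ^+ 2)%:E = \int[P]__ (f s ^+ 2)%:E)%E.
  by rewrite (integral_cst _ _ (_%:E))// (_ : (_ setT = 1)%E) ?mule1; [|exact: probability_setT].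
by under eq_integral do rewrite e.
Qed.

Theorem theorem4 (R : realType) (d : measure_display) (Omega : measurableType d)
    (P : probability Omega R) (F : R -> set (set Omega))
    (m : nat) (W : 'I_m -> R -> Omega -> R)
    (t T : R) (phi : nat -> R -> R) (i1 i2 : 'I_m)
    (I2 : Omega -> R) (xi eta : nat -> Omega -> R) (J : nat -> Omega -> R) :
  measure_is_complete P ->
  filtration F ->
  wiener_process P F W ->
  0 <= t -> t < T ->
  complete_orthonormal_system t T phi ->
  i1 != i2 ->
  is_iterated_ito P F (W i1) (W i2) t T I2 ->
  (forall j, is_ito P F (W i1) t T (fun s _ => phi j s) (xi j)) ->
  (forall j, is_ito P F (W i2) t T
     (fun s _ => \int[lebesgue_measure]_(x in `[t, s]) phi j x) (eta j)) ->
  (forall q w, J q w = \sum_(j < q.+1) xi j w * eta j w) ->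
  mean_square_lim P J I2 /\
  mean_square_lim P (fun q w => \sum_(j < q.+1) xi j w * eta j w) I2.
Proof.
move=> _ hF hW t0 tT cphi i12 [Y [iY iI]] ixi ieta JE.
suff h : mean_square_lim P (fun q w => \sum_(j < q.+1) xi j w * eta j w) I2.
  by split => //; rewrite (_ : J = fun q w => \sum_(j < q.+1) xi j w * eta j w)//;
    apply/funext => q; apply/funext => w.
pose mu := @lebesgue_measure R.
pose D : set R := `[t, T[%classic.
have mT := @measurableT _ Omega.
have mD : measurable (D : set (measurableTypeR R)) by exact: measurable_itv.
pose Phi j s : R := \int[mu]_(x in `[t, s]) phi j x.
have sphi j : sqi mu D (phi j) := cons_sqi cphi j.
have sPhi j : sqi mu D (Phi j).
  by apply: sqi_itv_co; apply: nonanticipating_sqi (ieta j).1.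
have wA j := ito_nonrandom hF hW t0 (sphi j) (ixi j).
have wB j := ito_nonrandom hF hW t0 (sPhi j) (ieta j).
have sxi j : sqi P setT (xi j) := (wA j).1.
have seta j : sqi P setT (eta j) := (wB j).1.
have /choice[A /choice[ga aA]] j := (wA j).2.
have /choice[B /choice[gb aB]] j := (wB j).2.
have [sI cI] := iterated_ito_grid hF hW t0 tT iY iI.
(* The xi_j inherit the orthonormality of the phi_j. *)
have oxi j k : ip P setT (xi j) (xi k) = (j == k)%:R.
  rewrite -(cons_orth cphi j k).
  exact: (wiener_isometry hF hW t0 (sphi j) (sphi k) (sxi j) (sxi k) (aA j) (aA k)).
pose V q s : Omega -> R := \sum_(j < q) Phi j s *: xi j - (W i1 s - W i1 t).
(* [Phi j s] is the coefficient of [W i1 s - W i1 t] along [xi j], so that [V q s] is the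
   remainder of a Fourier expansion in L_2(Omega). *)
have VE q s : D s -> ip P setT (V q s) (V q s) = s - t - \sum_(j < q) Phi j s ^+ 2.
  move=> Ds; have := Ds; rewrite /D /= in_itv/= => /andP[ts sT].
  have [sW _ eW] := incr_moments hF hW i1 t0 ts.
  have xW j : ip P setT (xi j) (W i1 s - W i1 t) = Phi j s.
    rewrite /Phi -(ip_indic_primitive ts sT (sphi j)).
    exact: (wiener_isometry hF hW t0 (sphi j) (sqi_indic_itv t T t s) (sxi j) sW (aA j)
      (wiener_approx_incr P W i1 ts (ltW sT))).
  have := ip_orthonormal_sub mT sxi sW oxi q (fun j => Phi j s).
  rewrite /= eW => e; rewrite /V ip_subC {}e.
  rewrite [X in _ + X = _]big1 ?addr0; last by move=> j _; rewrite xW subrr expr0n.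
  by congr (_ - _); apply: eq_bigr => j _; rewrite xW.
have [ir cr] := remainder_integral_cvg cphi sPhi.
have le q : (\int[P]_w ((\sum_(j < q) xi j w * eta j w - I2 w) ^+ 2)%:E <=
    (2 * \int[mu]_(s in D) (s - t - \sum_(j < q) Phi j s ^+ 2))%:E)%E.
  have -> : \int[mu]_(s in D) (s - t - \sum_(j < q) Phi j s ^+ 2) =
      \int[mu]_(s in D) ip P setT (V q s) (V q s).
    by apply: eq_Rintegral => s /set_mem Ds; rewrite VE.
  apply: (expansion_error_le hF hW t0 tT i12 sPhi sxi seta aA aB sI cI).
  have := ir q; apply: eq_integrable => // s Ds /=.
  by rewrite -(VE q s (set_mem Ds)).
(* Square integrability of the products comes from the bound itself. *)
have sJ q : sqi P setT (fun w => \sum_(j < q.+1) xi j w * eta j w).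
  have -> : (fun w => \sum_(j < q.+1) xi j w * eta j w) =
      (fun w => \sum_(j < q.+1) xi j w * eta j w - I2 w) + I2.
    by apply/funext => w; rewrite addrfctE subrK.
  apply: sqiD => //; split; last exact: le_lt_trans (le _) (ltry _).
  apply: measurable_funB; last by case: sI.
  by apply: measurable_sum => j; apply: measurable_funM; [case: (sxi j)|case: (seta j)].
apply/mean_square_limP; split => //.
have c2 := cvg0Z 2 cr; rewrite -cvg_shiftS in c2.
apply: (cvg0_le _ _ c2) => q; first exact: ip_ge0.
rewrite -lee_fin (ipE mT (sqiB mT (sJ q) sI)); exact: le.
Qed.
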